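(* Assume $\Sigma_w\succ0$, $W^{(1)}\succ0$, $W^{(2)}\succ0$, $\Sigma_0\succ0$ and $\beta>b_0:=\min_{\pi\in\Pi}\operatorname{Tr}(W^{(2)}\Sigma^{\pi})$. Let $M\prec0$ be a symmetric $d\times d$ matrix and let $\mu=\lambda_{\min}(W^{(2)})$. With $\Lambda$, $\pi_\lambda$, $b(\lambda)$ and $p^\star$ as defined in the context, the following hold. (i) With $\lambda_{\mathrm{crit}}:=\inf\Lambda$, we have $\Lambda=(\lambda_{\mathrm{crit}},\infty)$ with $0<\lambda_{\mathrm{crit}}\le\|M\|_2/\mu$. In particular, every $\lambda>\|M\|_2/\mu$ is admissible. (ii) $b(\cdot)$ is continuous and nonincreasing on $\Lambda$. (iii) For every admissible $\lambda$ with $b(\lambda)\le\beta$, the policy $\pi_\lambda$ is feasible for the problem defining $p^\star$ (that is, $\operatorname{Tr}(W^{(2)}\Sigma^{\pi_\lambda})\le\beta$) and $$\operatorname{Tr}(M\Sigma^{\pi_\lambda})\le p^\star+\lambda\big(\beta-b(\lambda)\big).$$ In particular, if $b(\lambda)=\beta$ then $\pi_\lambda$ is exactly optimal for that problem. (iv) $b(\lambda)\le\beta$ for all $$\lambda\ge\bar\lambda:=\frac{\beta}{\beta-b_0}\,\frac{\|M\|_2}{\mu}.$$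
   Context: Setting. Consider $x_{t+1}=Ax_t+Bu_t+w_t$, $x_0=0$, $t=0,\dots,H-1$, with $H$ a positive integer, $x_t\in\mathbb{R}^n$, $u_t\in\mathbb{R}^m$, $A\in\mathbb{R}^{n\times n}$, $B\in\mathbb{R}^{n\times m}$. The disturbances $w_t$ are i.i.d., zero mean, with covariance $\Sigma_w\succ0$. $\Pi$ is the set of causal, possibly randomized policies $\pi$: $u_t\sim\pi_t(x_0,\dots,x_t)$, where the internal randomization is independent of future disturbances $w_t,w_{t+1},\dots$; only policies for which the covariance below is finite are considered. Put $z_t=[x_t^\top\ u_t^\top]^\top\in\mathbb{R}^d$, $d=n+m$, and $$\Sigma^{\pi}=\mathbb{E}^{\pi}\Big[\sum_{t=0}^{H-1}z_tz_t^\top\Big]\succeq0 .$$ The matrices $W^{(1)},W^{(2)},\Sigma_0$ are symmetric $d\times d$ and $\beta>0$. Constrained problem. $$p^\star=\min_{\pi\in\Pi}\ \mathbb{E}^{\pi}\Big[\sum_{t=0}^{H-1}z_t^\top Mz_t\Big]=\min_{\pi\in\Pi}\operatorname{Tr}(M\Sigma^\pi)\quad\text{subject to}\quad\operatorname{Tr}(W^{(2)}\Sigma^{\pi})\le\beta .$$ Riccati recursion. For $\lambda\ge0$ let $\widetilde M(\lambda)=M+\lambda W^{(2)}$, partitioned conformally with $(x,u)$ into blocks $\widetilde M^{xx},\widetilde M^{xu},\widetilde M^{ux},\widetilde M^{uu}$. With $P_H(\lambda)=0$, define backward for $t=H-1,\dots,0$ $$S_t=\widetilde M^{uu}+B^\top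 P_{t+1}B,\qquad K_t=S_t^{-1}\big(\widetilde M^{ux}+B^\top P_{t+1}A\big),$$ $$P_t=\widetilde M^{xx}+A^\top P_{t+1}A-\big(\widetilde M^{ux}+B^\top P_{t+1}A\big)^\top K_t,$$ all depending on $\lambda$. The number $\lambda\ge 0$ is called admissible if $S_t(\lambda)\succ0$ for all $t=0,\dots,H-1$; $\Lambda\subseteq[0,\infty)$ is the set of admissible $\lambda$. For admissible $\lambda$, $\pi_\lambda$ is the linear feedback policy $u_t=-K_t(\lambda)x_t$ (the optimal policy for $\inf_{\pi\in\Pi}\mathbb{E}^\pi[\sum_{t=0}^{H-1}z_t^\top\widetilde M(\lambda)z_t]$), and $$b(\lambda)=\operatorname{Tr}\big(W^{(2)}\Sigma^{\pi_\lambda}\big).$$ $\|\cdot\|_2$ is the spectral norm. *)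

(* Defs.v *)
From HB Require Import structures.
From mathcomp Require Import all_boot all_order all_algebra.
From mathcomp Require Import all_classical all_reals all_analysis.
From mathcomp Require Import measurable_realfun.

Set Implicit Arguments.
Unset Strict Implicit.
Unset Printing Implicit Defensive.
Import Order.TTheory GRing.Theory Num.Theory.
Import numFieldNormedType.Exports.
Local Open Scope classical_set_scope.
Local Open Scope ring_scope.

(* MathComp-Analysis has no sigma-algebra on matrices: real matrices get the
   one generated by the entries, i.e. the product Borel sigma-algebra. *)
Definition matrix_display : measure_display.
Proof. exact: default_measure_display. Qed.

Section measurable_matrix.
Context {R : realType} {p q : nat}.

Definition measurable_mx : set (set 'M[R]_(p, q)) :=
  <<s \bigcup_(ij in [set: 'I_p * 'I_q])
        preimage_set_system setT (fun X : 'M[R]_(p, q) => X ij.1 ij.2)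
          measurable >>.

Let measurable_mx0 : measurable_mx set0.
Proof. exact: sigma_algebra0. Qed.

Let measurable_mxC X : measurable_mx X -> measurable_mx (~` X).
Proof. exact: sigma_algebraC. Qed.

Let measurable_mx_bigcup (F : (set 'M[R]_(p, q))^nat) :
  (forall i, measurable_mx (F i)) -> measurable_mx (\bigcup_i (F i)).
Proof. exact: sigma_algebra_bigcup. Qed.

HB.instance Definition _ := @isMeasurable.Build matrix_display
  'M[R]_(p, q) measurable_mx measurable_mx0 measurable_mxC
  measurable_mx_bigcup.

End measurable_matrix.

Lemma measurable_fun_mxP d (T : measurableType d) (R : realType) (p q : nat)
    (f : T -> 'M[R]_(p, q)) :
  measurable_fun setT f <->
  forall i j, measurable_fun setT (fun x => f x i j).
Proof.
split=> [mf i j _ Y mY|mf].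
  rewrite (_ : (fun x => f x i j) @^-1` Y =
    f @^-1` ((fun X : 'M[R]_(p, q) => X i j) @^-1` Y))//.
  apply: mf => //; apply: sub_sigma_algebra; exists (i, j) => //.
  by exists Y => //; rewrite setTI.
move=> _; suff : measurable_mx `<=`
  [set Y : set 'M[R]_(p, q) | measurable (setT `&` f @^-1` Y)] by [].
apply: smallest_sub.
  split=> /=.
  - by rewrite preimage_set0 setI0.
  - move=> Y; rewrite !setTI => mY.
    by rewrite setTD preimage_setC; exact: measurableC.
  - move=> F mF; rewrite setTI preimage_bigcup; apply: bigcup_measurable => k _.
    by have := mF k; rewrite setTI.
move=> Y [[i j] _ [Z mZ <-]] /=; rewrite !setTI.
by have := mf i j measurableT Z mZ; rewrite setTI.
Qed.

Section matrix_notions.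
Context {R : realType} {d : nat}.

Definition posdef (X : 'M[R]_d) : Prop :=
  X^T = X /\ forall v : 'cV[R]_d, v != 0 -> 0 < (v^T *m X *m v) 0 0.

Definition negdef (X : 'M[R]_d) : Prop := posdef (- X).

Definition norm2 (v : 'cV[R]_d) : R := Num.sqrt (\sum_i v i 0 ^+ 2).

Definition spectral_norm (X : 'M[R]_d) : R :=
  sup [set norm2 (X *m v) | v in [set v | norm2 v = 1]].

Definition lambda_min (X : 'M[R]_d) : R := inf [set a | eigenvalue X a].

End matrix_notions.

Section disturbances.
Context {dT : measure_display} {T : measurableType dT} {R : realType}.
Context {n : nat} (P : probability T R) (H : nat) (w : nat -> T -> 'cV[R]_n).
Local Open Scope ereal_scope.

(* Since some of the events [E t] may be [setT], this is the product rule for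
   every subfamily of [w 0, ..., w (H - 1)]. *)
Definition mutually_independent : Prop :=
  forall E : nat -> set 'cV[R]_n, (forall t, measurable (E t)) ->
    P (\bigcap_(t in `I_H) w t @^-1` E t) = \prod_(t < H) P (w t @^-1` E t).

Definition identically_distributed : Prop :=
  forall s t, (s < H)%N -> (t < H)%N -> forall E : set 'cV[R]_n,
    measurable E -> P (w s @^-1` E) = P (w t @^-1` E).

Definition iid : Prop :=
  (forall t, (t < H)%N -> measurable_fun setT (w t)) /\
  mutually_independent /\ identically_distributed.

Definition zero_mean : Prop :=
  forall t i, (t < H)%N ->
    P.-integrable setT (EFin \o (fun x => w t x i ord0)) /\
    \int[P]_x (w t x i ord0)%:E = 0.

(* For a zero mean vector. *)
Definition has_covariance (Sigma_w : 'M[R]_n) : Prop :=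
  forall t i j, (t < H)%N ->
    P.-integrable setT (EFin \o (fun x => w t x i ord0 * w t x j ord0)%R) /\
    \int[P]_x (w t x i ord0 * w t x j ord0)%:E = (Sigma_w i j)%:E.

End disturbances.

(* A causal randomized policy, u_t ~ pi_t(x_0, ..., x_t): the input is a
   measurable function of the states observed so far and of an internal random
   seed. Any probability space may serve as seed, so a sequence of stochastic
   kernels, with fresh randomization at each step, is a special case. *)
Record policy (R : realType) (n m : nat) := Policy {
  seed_display : measure_display;
  seed : measurableType seed_display;
  seed_law : probability seed R;
  act : forall t : nat, seed -> t.+1.-tuple 'cV[R]_n -> 'cV[R]_m;
  measurable_act : forall t, measurable_fun setT
    (fun q : seed * t.+1.-tuple 'cV[R]_n => act q.1 q.2) }.

Arguments act {R n m} p t _ _.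

Section closed_loop.
Context {dT : measure_display} {T : measurableType dT} {R : realType}.
Context {n m : nat}.
Context (P : probability T R) (H : nat) (A : 'M[R]_n) (B : 'M[R]_(n, m)).
Context (w : nat -> T -> 'cV[R]_n).

Section trajectory.
Context (pi : policy R n m).

(* The closed loop lives on [T * seed pi] with the product measure, so that
   the seed is independent of the disturbances. Compared with randomization
   independent of the current and future disturbances only, the attainable laws
   of states and inputs are the same: past disturbances are determined by past
   states and inputs. *)
Fixpoint states (t : nat) (om : T * seed pi) : t.+1.-tuple 'cV[R]_n :=
  match t with
  | 0 => [tuple 0]
  | s.+1 =>
      let h := states s om in
      [tuple of rcons h
        (A *m tnth h ord_max + B *m act pi s om.2 h + w s om.1)]
  end.

Definition state (t : nat) (om : T * seed pi) : 'cV[R]_n :=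
  tnth (states t om) ord_max.

Definition input (t : nat) (om : T * seed pi) : 'cV[R]_m :=
  act pi t om.2 (states t om).

Definition zvec (t : nat) (om : T * seed pi) : 'cV[R]_(n + m) :=
  col_mx (state t om) (input t om).

Definition Sigma : 'M[R]_(n + m) :=
  \matrix_(i, j) \int[(P \x seed_law pi)%E]_om
    (\sum_(t < H) zvec t om *m (zvec t om)^T) i j.

Definition finite_covariance : Prop :=
  forall (t : nat) (i : 'I_(n + m)), (t < H)%N ->
    (P \x seed_law pi)%E.-integrable setT
      (EFin \o (fun om => zvec t om i 0 ^+ 2)).

End trajectory.

(* Classes of policies are predicates, as [set (policy R n m)] would be
   universe inconsistent. Minimal values over such classes are infima. *)
Definition Pi (pi : policy R n m) : Prop := finite_covariance pi.

Definition min_cost (W : 'M[R]_(n + m)) : R :=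
  inf [set c | exists2 pi, Pi pi & c = \tr (W *m Sigma pi)].

Definition feasible (W2 : 'M[R]_(n + m)) (beta : R) (pi : policy R n m) :
    Prop :=
  Pi pi /\ \tr (W2 *m Sigma pi) <= beta.

Definition pstar (M W2 : 'M[R]_(n + m)) (beta : R) : R :=
  inf [set c | exists2 pi, feasible W2 beta pi & c = \tr (M *m Sigma pi)].

Definition optimal (M W2 : 'M[R]_(n + m)) (beta : R) (pi : policy R n m) :
    Prop :=
  feasible W2 beta pi /\
  forall pi', feasible W2 beta pi' ->
    \tr (M *m Sigma pi) <= \tr (M *m Sigma pi').

Section riccati.
Context (M W2 : 'M[R]_(n + m)) (lam : R).

Definition Mtilde : 'M[R]_(n + m) := M + lam *: W2.

Definition riccati_S (X : 'M[R]_n) : 'M[R]_m :=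
  drsubmx Mtilde + B^T *m X *m B.

Definition riccati_K (X : 'M[R]_n) : 'M[R]_(m, n) :=
  invmx (riccati_S X) *m (dlsubmx Mtilde + B^T *m X *m A).

Definition riccati_step (X : 'M[R]_n) : 'M[R]_n :=
  ulsubmx Mtilde + A^T *m X *m A
  - (dlsubmx Mtilde + B^T *m X *m A)^T *m riccati_K X.

Definition P_ (t : nat) : 'M[R]_n := iter (H - t) riccati_step 0.
Definition S_ (t : nat) : 'M[R]_m := riccati_S (P_ t.+1).
Definition K_ (t : nat) : 'M[R]_(m, n) := riccati_K (P_ t.+1).

Lemma P_terminal : P_ H = 0.
Proof. by rewrite /P_ subnn. Qed.

Lemma P_backward t : (t < H)%N ->
  P_ t = ulsubmx Mtilde + A^T *m P_ t.+1 *m A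
         - (dlsubmx Mtilde + B^T *m P_ t.+1 *m A)^T *m K_ t.
Proof. by move=> tH; rewrite {1}/P_ -(subnSK tH). Qed.

Lemma measurable_feedback t : measurable_fun setT
  (fun q : unit * t.+1.-tuple 'cV[R]_n => - K_ t *m tnth q.2 ord_max).
Proof.
apply/measurable_fun_mxP => i j.
under eq_fun do rewrite mxE.
apply: measurable_sum => k; apply: measurable_funM; first exact: measurable_cst.
have : measurable_fun setT
    (fun q : unit * t.+1.-tuple 'cV[R]_n => tnth q.2 ord_max).
  exact: (measurableT_comp (measurable_tnth ord_max) measurable_snd).
by move/measurable_fun_mxP; exact.
Qed.

Definition feedback : policy R n m :=
  @Policy R n m _ unit (dirac tt)
    (fun t _ h => - K_ t *m tnth h ord_max) measurable_feedback.

End riccati.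

Definition Lambda (M W2 : 'M[R]_(n + m)) : set R :=
  [set lam | 0 <= lam /\ forall t, (t < H)%N -> posdef (S_ M W2 lam t)].

(* [invmx] makes this total; off [Lambda M W2] the gains are junk, except that
   the value is 0 whenever the state is identically 0. *)
Definition budget (M W2 : 'M[R]_(n + m)) (lam : R) : R :=
  \tr (W2 *m Sigma (feedback M W2 lam)).

End closed_loop.

(* Main.v *)
Require Import Defs.
From mathcomp Require Import all_boot all_order all_algebra.
From mathcomp Require Import all_classical all_reals all_analysis.
From mathcomp Require Import measurable_realfun.
From mathcomp Require Import ring lra zify.

(** Everything follows from one identity for the Lagrangian cost
    [tr ((M + lam W2) Sigma)] of a policy. Completing the square in the input at
    each stage, with the Riccati matrices [P_t], [S_t] and gains [K_t], and
    telescoping along the dynamics ([cost_decomposition]), this cost is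
      [sum_t tr (P_{t+1} Sigma_w) + sum_t E[e_t^T S_t e_t]],
    where [e_t = u_t + K_t x_t].
    The first sum does not depend on the policy; for admissible [lam] the second
    one is nonnegative and vanishes for [u_t = - K_t x_t], so that the feedback
    [pi_lam] minimizes the Lagrangian over all causal policies
    ([lagrangian_optimal]).

    Probability enters only through the second moments [Z_t = E[z_t z_t^T]]. The
    disturbance [w_t] is independent of the seed and of the earlier
    disturbances, of which [x_t] and [u_t] are measurable functions; being
    centered it is orthogonal to them, so the state block of [Z_{t+1}] is
    [F Z_t F^T + Sigma_w] with [F = (A B)] ([policy_moment_sequence]).

    (i) The minimum over [u] of a form increasing in [lam] is increasing too, so
    admissibility passes to larger multipliers ([Lambda_up]). The [S_t] depend
    continuously on [lam] as long as the previous ones are invertible, and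
    positive definiteness is an open condition, so there is no least admissible
    multiplier ([Lambda_open]). At [lam] near [0] the last [S_t] is not positive
    definite because [M] is negative definite, while beyond [|M|_2 / mu] the
    matrix [M + lam W2] itself is positive definite.

    (ii) Monotonicity is the exchange argument for two Lagrangian minimizers;
    continuity holds because the second moments under [pi_lam] obey a linear
    recursion with continuous coefficients.

    (iii) A feasible competitor satisfies [tr (W2 Sigma) <= beta]; inserting
    this in the optimality of [pi_lam] gives the bound.

    (iv) Put [r = |M|_2 / mu]. Comparing [pi_lam] with an arbitrary policy, and
    using [- r W2 <= M <= 0], gives [(lam - r) b(lam) <= lam b0], and the right
    side is at most [(lam - r) beta] from the threshold on. The threshold may
    equal [r], outside the admissible set, only if [b0 = 0]; then the state is
    identically zero and so is the budget. *)

Set Implicit Arguments.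
Unset Strict Implicit.
Unset Printing Implicit Defensive.
Import Order.TTheory GRing.Theory Num.Theory.
Import numFieldNormedType.Exports.
Local Open Scope classical_set_scope.
Local Open Scope ring_scope.

(** * Quadratic forms, spectral norm and smallest eigenvalue *)

Lemma norm_mul_le (R : realDomainType) (a b c : R) :
  a ^+ 2 <= c -> b ^+ 2 <= c -> `|a * b| <= c.
Proof.
move=> ac bc; have := sqr_ge0 (a - b); have := sqr_ge0 (a + b).
rewrite sqrrB sqrrD ler_norml => h1 h2; apply/andP; split; lra.
Qed.

Section quadratic_forms.
Context {R : realType} {d : nat}.
Implicit Types (W X S : 'M[R]_d) (u v : 'cV[R]_d).

Definition qf W v : R := (v^T *m W *m v) 0 0.

Definition psd W := forall v, 0 <= qf W v.

Lemma qfE W v : qf W v = \sum_i \sum_j W i j * (v i 0 * v j 0).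
Proof.
rewrite /qf mxE exchange_big /=; apply: eq_bigr => j _.
rewrite mxE mulr_suml; apply: eq_bigr => i _; rewrite mxE; ring.
Qed.

Lemma qfD W X v : qf (W + X) v = qf W v + qf X v.
Proof. by rewrite /qf mulmxDr mulmxDl mxE. Qed.

Lemma qfZ a W v : qf (a *: W) v = a * qf W v.
Proof. by rewrite /qf -scalemxAr -scalemxAl mxE. Qed.

Lemma qfN W v : qf (- W) v = - qf W v.
Proof. by rewrite -scaleN1r qfZ mulN1r. Qed.

Lemma qf_scale W a v : qf W (a *: v) = a ^+ 2 * qf W v.
Proof.
by rewrite /qf [(a *: v)^T]linearZ /= -!scalemxAl -scalemxAr scalerA mxE expr2.
Qed.

Lemma qf0 W : qf W 0 = 0. Proof. by rewrite /qf mulmx0 mxE. Qed.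

Lemma qf1E v : qf 1%:M v = \sum_i v i 0 ^+ 2.
Proof. by rewrite /qf mulmx1 mxE; apply: eq_bigr => i _; rewrite mxE expr2. Qed.

Lemma qf1_ge0 v : 0 <= qf 1%:M v.
Proof. by rewrite qf1E; apply: sumr_ge0 => i _; exact: sqr_ge0. Qed.

Lemma qf1_eq0 v : qf 1%:M v = 0 -> v = 0.
Proof.
rewrite qf1E => /eqP; rewrite psumr_eq0; last by move=> i _; exact: sqr_ge0.
move=> /allP v0; apply/colP => i; rewrite mxE; apply/eqP.
by have := v0 i (mem_index_enum _); rewrite /= sqrf_eq0.
Qed.

Lemma qf1_gt0 v : v != 0 -> 0 < qf 1%:M v.
Proof.
move=> v0; rewrite lt0r qf1_ge0 andbT; apply: contra v0 => /eqP.
by move=> /qf1_eq0 ->.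
Qed.

Lemma posdef_psd W : posdef W -> psd W.
Proof.
by move=> [_ W0] v; have [->|/W0/ltW//] := eqVneq v 0; rewrite qf0.
Qed.

Lemma psd1 : psd 1%:M. Proof. exact: qf1_ge0. Qed.

Lemma bilin_sym W u v : W^T = W -> (u^T *m W *m v) 0 0 = (v^T *m W *m u) 0 0.
Proof.
move=> WT; rewrite -[in LHS](trmxK (u^T *m W *m v)) mxE.
by rewrite !trmx_mul trmxK WT mulmxA.
Qed.

Lemma qf_line W u v t : W^T = W ->
  qf W (u + t *: v) = qf W u + 2 * t * (u^T *m W *m v) 0 0 + t ^+ 2 * qf W v.
Proof.
move=> WT; rewrite -qf_scale /qf [(u + _)^T]linearD /= !mulmxDl !mulmxDr.
rewrite [((t *: v)^T)]linearZ /= -!scalemxAl -!scalemxAr.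
set a := u^T *m W *m u; set b := u^T *m W *m v; set c := _ *m _ *m v.
have -> : v^T *m W *m u = (b 0 0)%:M.
  by rewrite [LHS]mx11_scalar /b bilin_sym.
rewrite !mxE eqxx mulr1n; ring.
Qed.

(** The form is only semidefinite, so when [qf W v = 0] the usual optimal
    shift along [v] is not available; then the form is affine in the shift and
    nonnegative, so its slope vanishes. *)
Lemma cauchy_schwarz W u v : W^T = W -> psd W ->
  (u^T *m W *m v) 0 0 ^+ 2 <= qf W u * qf W v.
Proof.
move=> WT W0; set b := (_ 0 0).
have line t : 0 <= qf W u + 2 * t * b + t ^+ 2 * qf W v.
  by rewrite -qf_line.
have := W0 v; rewrite le0r => /predU1P[v0|v0]; last first.
  have := line (- b / qf W v).
  rewrite (_ : _ + _ + _ = qf W u - b ^+ 2 / qf W v); last first.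
    by field; rewrite gt_eqF.
  by rewrite subr_ge0 ler_pdivrMr.
have [->|b0] := eqVneq b 0; first by rewrite expr0n /= mulr_ge0.
(* a shift at which the affine function takes the value -1 *)
have := line (- (qf W u + 1) / (2 * b)); rewrite v0 mulr0 addr0.
rewrite (_ : _ + _ = -1); first by rewrite lerNr oppr0 ler10.
by field.
Qed.

(** Cauchy-Schwarz for the pair [W v], [v] bounds the square of
    [(W v)^T W v = |W v|^2] by a multiple of [qf W v]. *)
Lemma psd_ker W v : W^T = W -> psd W -> qf W v = 0 -> W *m v = 0.
Proof.
move=> WT W0 v0; apply: qf1_eq0; apply/eqP; rewrite -sqrf_eq0.
rewrite eq_le sqr_ge0 andbT.
have -> : qf 1%:M (W *m v) = ((W *m v)^T *m W *m v) 0 0.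
  by rewrite /qf mulmx1 -mulmxA.
by rewrite (le_trans (cauchy_schwarz _ _ WT W0)) // v0 mulr0.
Qed.

(** A crude norm, convenient because it is visibly continuous in the entries
    and controls the quadratic form. *)
Definition norm_sum W := \sum_i \sum_j `|W i j|.

Lemma norm_sum_ge0 W : 0 <= norm_sum W.
Proof. by apply: sumr_ge0 => i _; apply: sumr_ge0. Qed.

Lemma qf_bound W v : `|qf W v| <= norm_sum W * qf 1%:M v.
Proof.
rewrite qfE (le_trans (ler_norm_sum _ _ _)) // mulr_suml.
apply: ler_sum => i _; rewrite (le_trans (ler_norm_sum _ _ _)) // mulr_suml.
apply: ler_sum => j _; rewrite normrM; apply: ler_wpM2l => //.
have coord k : v k 0 ^+ 2 <= qf 1%:M v.
  rewrite qf1E (bigD1 k) //= lerDl; apply: sumr_ge0 => l _.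
  exact: sqr_ge0.
exact: norm_mul_le.
Qed.

Lemma posdef_unitmx S : posdef S -> S \in unitmx.
Proof.
move=> [_ S0]; rewrite -row_free_unit -kermx_eq0; apply/negPn/negP.
move=> /rowV0Pn[u /sub_kermxP uS u0].
have v0 : u^T != 0 by rewrite -(inj_eq trmx_inj) trmxK trmx0.
by have := S0 _ v0; rewrite trmxK uS mul0mx mxE ltxx.
Qed.

(** As [|v|^2 = (S^-1 v)^T S v], Cauchy-Schwarz for the form [S] gives
    [|v|^4 <= (v^T S^-1 v) (v^T S v) <= c |v|^2 (v^T S v)]. *)
Lemma posdef_coercive S : posdef S ->
  exists2 e : R, 0 < e & forall v, e * qf 1%:M v <= qf S v.
Proof.
move=> pS; have uS := posdef_unitmx pS; have S0 := posdef_psd pS.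
have [ST _] := pS.
pose c := norm_sum (invmx S) + 1.
have c0 : 0 < c by rewrite ltr_wpDl ?norm_sum_ge0.
exists c^-1; first by rewrite invr_gt0.
move=> v; rewrite ler_pdivrMl //.
have := cauchy_schwarz (invmx S *m v) v ST S0.
have -> : (invmx S *m v)^T *m S *m v = v^T *m 1%:M *m v.
  by rewrite trmx_mul trmx_inv ST -!mulmxA mulKmx // mul1mx.
have -> : qf S (invmx S *m v) = qf (invmx S) v.
  by rewrite /qf trmx_mul trmx_inv ST -!mulmxA mulKVmx.
rewrite -/(qf 1%:M v) => le1.
have := qf_bound (invmx S) v; rewrite ler_norml => /andP[_ le2].
have [v0|v0] := eqVneq (qf 1%:M v) 0; first by rewrite v0 mulr_ge0 // ltW.
have vp : 0 < qf 1%:M v by rewrite lt0r v0 qf1_ge0.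
rewrite -(ler_pM2l vp) -expr2 (le_trans le1) //.
rewrite mulrA ler_wpM2r // (le_trans le2) // mulrC ler_wpM2l ?qf1_ge0 //.
by rewrite /c lerDl.
Qed.

Lemma posdefP S : S^T = S ->
  posdef S <-> exists2 e : R, 0 < e & forall v, e * qf 1%:M v <= qf S v.
Proof.
move=> ST; split; first exact: posdef_coercive.
move=> [e e0 Se]; split=> // v v0; rewrite -/(qf S v).
by apply: lt_le_trans (Se v); rewrite mulr_gt0 ?qf1_gt0.
Qed.

Lemma norm2_sqr v : norm2 v ^+ 2 = qf 1%:M v.
Proof. by rewrite /norm2 -qf1E sqr_sqrtr // qf1_ge0. Qed.

Lemma norm2_ge0 v : 0 <= norm2 v. Proof. exact: sqrtr_ge0. Qed.

Lemma norm2Z a v : 0 <= a -> norm2 (a *: v) = a * norm2 v.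
Proof.
move=> a0; rewrite /norm2 -!qf1E qf_scale sqrtrM ?sqr_ge0 //.
by rewrite sqrtr_sqr ger0_norm.
Qed.

Lemma norm2_gt0 v : v != 0 -> 0 < norm2 v.
Proof. by move=> v0; rewrite /norm2 -qf1E sqrtr_gt0 qf1_gt0. Qed.

Lemma norm2_normalized v : v != 0 -> norm2 ((norm2 v)^-1 *: v) = 1.
Proof.
move=> v0; rewrite norm2Z ?invr_ge0 ?norm2_ge0 // mulVf //.
by rewrite gt_eqF // norm2_gt0.
Qed.

Lemma exists_norm2_1 : (0 < d)%N -> exists v : 'cV[R]_d, norm2 v = 1.
Proof.
move=> d0; exists ((norm2 (const_mx 1 : 'cV_d))^-1 *: const_mx 1).
apply: norm2_normalized; apply/eqP => /colP /(_ (Ordinal d0)).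
rewrite !mxE => /eqP.
by rewrite oner_eq0.
Qed.

Lemma norm2_mul_le W v : norm2 (W *m v) <= spectral_norm W * norm2 v.
Proof.
have [->|v0] := eqVneq v 0.
  rewrite mulmx0 /norm2 -qf1E qf0 sqrtr0 mulr0 //.
rewrite -ler_pdivrMr ?norm2_gt0 //.
apply: sup_upper_bound; last first.
  exists ((norm2 v)^-1 *: v); first exact: norm2_normalized.
  by rewrite -scalemxAr norm2Z ?invr_ge0 ?norm2_ge0 // mulrC.
split; first by exists (norm2 (W *m ((norm2 v)^-1 *: v)));
  exists ((norm2 v)^-1 *: v) => //; exact: norm2_normalized.
exists (Num.sqrt (norm_sum (W^T *m W))) => _ [u /= u1 <-].
rewrite /norm2 -qf1E ler_sqrt ?norm_sum_ge0 //.
have -> : qf 1%:M (W *m u) = qf (W^T *m W) u.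
  by rewrite /qf mulmx1 trmx_mul !mulmxA.
have := qf_bound (W^T *m W) u; rewrite -norm2_sqr u1 expr1n mulr1.
by apply: le_trans; exact: ler_norm.
Qed.

Lemma spectral_normP W v : `|qf W v| <= spectral_norm W * qf 1%:M v.
Proof.
have le1 : `|qf W v| <= norm2 v * norm2 (W *m v).
  rewrite -ler_sqr ?nnegrE ?mulr_ge0 ?norm2_ge0 //.
  rewrite real_normK ?num_real // exprMn !norm2_sqr.
  have := cauchy_schwarz v (W *m v) (trmx1 _ _) psd1.
  by rewrite mulmx1 mulmxA.
rewrite (le_trans le1) // -norm2_sqr expr2 mulrCA ler_wpM2l ?norm2_ge0 //.
exact: norm2_mul_le.
Qed.

Lemma spectral_norm_gt0 W : (0 < d)%N -> negdef W -> 0 < spectral_norm W.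
Proof.
move=> d0 [_ W0]; have [v v1] := exists_norm2_1 d0.
have v0 : v != 0.
  apply/eqP => v0; move: v1; rewrite v0 /norm2 -qf1E qf0 sqrtr0 => /eqP.
  by rewrite eq_sym oner_eq0.
have := W0 v v0; rewrite -/(qf _ _) qfN => lt1.
have := spectral_normP W v; rewrite -norm2_sqr v1 expr1n mulr1.
by apply: lt_le_trans; rewrite normr_gt0 -oppr_eq0 gt_eqF.
Qed.

(** Let [c] be the infimum of [qf W] on the unit sphere. Then [W - c I] is
    positive semidefinite but not positive definite, since coercivity would
    increase the infimum; a vector on which its form vanishes lies in its
    kernel, so [c] is an eigenvalue, and it bounds the others from below. *)
Lemma lambda_min_spec W : (0 < d)%N -> W^T = W ->
  (forall v, lambda_min W * qf 1%:M v <= qf W v) /\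
  exists2 v, v != 0 & qf W v = lambda_min W * qf 1%:M v.
Proof.
move=> d0 WT.
pose V := [set qf W v | v in [set v | norm2 v = 1]].
have hV : has_inf V.
  split; first by have [v v1] := exists_norm2_1 d0; exists (qf W v); exists v.
  exists (- norm_sum W) => _ [v /= v1 <-].
  have := qf_bound W v; rewrite -norm2_sqr v1 expr1n mulr1 ler_norml.
  by case/andP.
pose c := inf V.
have cP v : c * qf 1%:M v <= qf W v.
  have [->|v0] := eqVneq v 0; first by rewrite !qf0 mulr0.
  rewrite -norm2_sqr -ler_pdivlMr ?exprn_gt0 ?norm2_gt0 //.
  apply: (inf_lbound hV.2); exists ((norm2 v)^-1 *: v).
    exact: norm2_normalized.
  by rewrite qf_scale exprVn mulrC.
pose X := W - c%:M.
have XE v : qf X v = qf W v - c * qf 1%:M v.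
  by rewrite /X -(scalemx1 _ c) qfD qfN qfZ.
have XT : X^T = X by rewrite /X linearB /= WT tr_scalar_mx.
have X0 : psd X by move=> v; rewrite XE subr_ge0.
have [v v0 Wv] : exists2 v, v != 0 & qf X v = 0.
  apply: contrapT => nX.
  have /posdef_coercive[e e0 Xe] : posdef X.
    split=> // v v0; rewrite -/(qf X v) lt0r X0 andbT.
    by apply/eqP => Xv; apply: nX; exists v.
  have : c + e <= c.
    apply: lb_le_inf; first exact: hV.1.
    move=> _ [v /= v1 <-]; have := Xe v.
    by rewrite XE -norm2_sqr v1 expr1n !mulr1 lerBrDl.
  by rewrite gerDl leNgt e0.
have {}Wv : W *m v = c *: v.
  have := psd_ker XT X0 Wv; rewrite /X mulmxBl mul_scalar_mx.
  by move/eqP; rewrite subr_eq0 => /eqP.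
have eig : eigenvalue W c.
  apply/eigenvalueP; exists v^T; last by rewrite -(inj_eq trmx_inj) trmxK trmx0.
  by rewrite -{1}WT -trmx_mul Wv linearZ.
have lbc : lbound [set a | eigenvalue W a] c.
  move=> a /= /eigenvalueP[u uW u0].
  have u0' : u^T != 0 by rewrite -(inj_eq trmx_inj) trmxK trmx0.
  have uE : qf W u^T = a * qf 1%:M u^T.
    by rewrite /qf trmxK uW mulmx1 -scalemxAl [LHS]mxE.
  by have := cP u^T; rewrite uE ler_pM2r // qf1_gt0.
have -> : lambda_min W = c.
  apply/eqP; rewrite eq_le; apply/andP; split.
    by apply: inf_lbound => //; exists c.
  by apply: lb_le_inf => //; exists c.
split=> //; exists v => //.
by rewrite /qf -[v^T *m W *m v]mulmxA Wv mulmx1 -scalemxAr [LHS]mxE.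
Qed.

Lemma lambda_min_gt0 W : (0 < d)%N -> posdef W -> 0 < lambda_min W.
Proof.
move=> d0 [WT W0]; have [_ [v v0 vE]] := lambda_min_spec d0 WT.
by have := W0 v v0; rewrite -/(qf W v) vE pmulr_lgt0 // qf1_gt0.
Qed.

End quadratic_forms.

Lemma qf_mul (R : realType) d e (L : 'M[R]_(e, d)) (W : 'M[R]_e) v :
  qf (L^T *m W *m L) v = qf W (L *m v).
Proof. by rewrite /qf trmx_mul !mulmxA. Qed.

Lemma psd_conj (R : realType) d e (L : 'M[R]_(e, d)) (W : 'M[R]_e) :
  psd W -> psd (L^T *m W *m L).
Proof. by move=> W0 v; rewrite qf_mul. Qed.

(** * Completion of the square and admissible multipliers *)

Section riccati_algebra.
Context {R : realType} {n m : nat}.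
Context (A : 'M[R]_n) (B : 'M[R]_(n, m)) (M W2 : 'M[R]_(n + m)).
Hypotheses (MT : M^T = M) (W2T : W2^T = W2).
Implicit Types (lam : R) (X : 'M[R]_n) (Z W : 'M[R]_(n + m)).

Local Notation F := (row_mx A B).
Local Notation Ex := (row_mx 1%:M 0 : 'M[R]_(n, n + m)).
Local Notation Mt := (Mtilde M W2).
Local Notation rS := (riccati_S B M W2).
Local Notation rK := (riccati_K A B M W2).
Local Notation step := (riccati_step A B M W2).

Lemma Mtilde_sym lam : (Mt lam)^T = Mt lam.
Proof. by rewrite /Mtilde linearD linearZ /= MT W2T. Qed.

Lemma ur_Mtilde lam : ursubmx (Mt lam) = (dlsubmx (Mt lam))^T.
Proof. by rewrite trmx_dlsub Mtilde_sym. Qed.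

Lemma quad_sym p q (C : 'M[R]_(p, q)) (Y : 'M[R]_p) :
  Y^T = Y -> (C^T *m Y *m C)^T = C^T *m Y *m C.
Proof. by move=> YT; rewrite !trmx_mul trmxK YT mulmxA. Qed.

Lemma riccati_S_sym lam X : X^T = X -> (rS lam X)^T = rS lam X.
Proof.
move=> XT; rewrite /riccati_S [(_ + _)^T]linearD /= quad_sym //.
by rewrite trmx_drsub Mtilde_sym.
Qed.

Lemma riccati_step_sym lam X : X^T = X -> (step lam X)^T = step lam X.
Proof.
move=> XT; rewrite /riccati_step /riccati_K.
set b := dlsubmx _ + _; rewrite [(_ - _)^T]linearB /= [(_ + _)^T]linearD /=.
rewrite quad_sym // trmx_ulsub Mtilde_sym; congr (_ - _).
by rewrite mulmxA !trmx_mul trmxK trmx_inv riccati_S_sym // mulmxA.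
Qed.

Lemma iter_step_sym lam k : (iter k (step lam) 0)^T = iter k (step lam) 0.
Proof. by elim: k => [|k IH]; rewrite ?trmx0 //= riccati_step_sym. Qed.

(** For [z = (x, u)], the vector [residual_mx K *m z = K x + u] measures the
    deviation of the input from the feedback [u = - K x]. *)
Definition residual_mx (K : 'M[R]_(m, n)) : 'M[R]_(m, n + m) := row_mx K 1%:M.
Definition feedback_mx (K : 'M[R]_(m, n)) : 'M[R]_(n + m, n) :=
  col_mx 1%:M (- K).

(** One step of dynamic programming: stage cost plus cost-to-go equals the
    new cost-to-go plus a penalty on the deviation from the Riccati feedback.
    The off-diagonal blocks agree because [S K] is the lower left block of the
    left-hand side. *)
Lemma complete_square lam X : X^T = X -> rS lam X \in unitmx ->
  Mt lam + F^T *m X *m F =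
  Ex^T *m step lam X *m Ex
  + (residual_mx (rK lam X))^T *m rS lam X *m residual_mx (rK lam X).
Proof.
move=> XT uS; have ST := riccati_S_sym lam XT.
have SK : rS lam X *m rK lam X = dlsubmx (Mt lam) + B^T *m X *m A.
  by rewrite /riccati_K mulKVmx.
have KS : (rK lam X)^T *m rS lam X = (dlsubmx (Mt lam) + B^T *m X *m A)^T.
  by rewrite -SK [RHS]trmx_mul ST.
rewrite /residual_mx !tr_row_mx !mul_col_mx !mul_mx_row.
rewrite !trmx1 !trmx0 !mulmx1 !mul1mx !mul0mx !mulmx0 KS SK.
rewrite -{1}(submxK (Mt lam)) -?block_mxEv -?block_mxEh.
rewrite !add_block_mx !add0r; congr block_mx => //.
  by rewrite /riccati_step -mulmxA subrK.
by rewrite ur_Mtilde [RHS]linearD /= !trmx_mul trmxK XT mulmxA.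
Qed.

Lemma state_feedback_mx K : Ex *m feedback_mx K = 1%:M.
Proof. by rewrite mul_row_col mulmx1 mul0mx addr0. Qed.

Lemma residual_feedback_mx K : residual_mx K *m feedback_mx K = 0.
Proof. by rewrite mul_row_col mulmx1 mul1mx subrr. Qed.

Lemma qf_complete_square lam X z : X^T = X -> rS lam X \in unitmx ->
  qf (Mt lam + F^T *m X *m F) z =
  qf (step lam X) (Ex *m z) + qf (rS lam X) (residual_mx (rK lam X) *m z).
Proof. by move=> XT uS; rewrite complete_square // qfD !qf_mul. Qed.

(** The new cost-to-go is the value at the feedback input, hence a minimum over
    inputs when [S] is positive definite; monotonicity below rests on this. *)
Lemma qf_step lam X x : X^T = X -> rS lam X \in unitmx ->
  qf (step lam X) x =
  qf (Mt lam + F^T *m X *m F) (feedback_mx (rK lam X) *m x).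
Proof.
move=> XT uS; rewrite qf_complete_square // !mulmxA.
rewrite state_feedback_mx residual_feedback_mx.
by rewrite mul1mx mul0mx qf0 addr0.
Qed.

Lemma qf_rS lam X v :
  qf (rS lam X) v = qf (Mt lam + F^T *m X *m F) (col_mx 0 v).
Proof.
have <- : col_mx 0 1%:M *m v = col_mx 0 v :> 'cV_(n + m).
  by rewrite mul_col_mx mul0mx mul1mx.
rewrite -qf_mul; congr qf; rewrite /riccati_S.
rewrite mulmxDr mulmxDl; congr (_ + _).
  rewrite -{2}(submxK (Mt lam)) tr_col_mx mul_row_block mul_row_col.
  by rewrite !trmx0 trmx1 !mul0mx !mulmx0 !mul1mx mulmx1 !add0r.
rewrite -!mulmxA mul_row_col mulmx0 add0r mulmx1 !mulmxA -trmx_mul.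
by rewrite mul_row_col mulmx0 add0r mulmx1.
Qed.

Lemma quad_mono lam1 lam2 X1 X2 : psd W2 -> lam1 <= lam2 ->
  (forall v, qf X1 v <= qf X2 v) ->
  forall z, qf (Mt lam1 + F^T *m X1 *m F) z <= qf (Mt lam2 + F^T *m X2 *m F) z.
Proof.
move=> W0 le12 leX z; rewrite /Mtilde !qfD !qfZ !qf_mul.
by apply: lerD => //; rewrite lerD2l ler_wpM2r.
Qed.

(** A minimum over inputs of a form increasing in the multiplier and in the
    cost-to-go is itself increasing. *)
Lemma riccati_mono lam1 lam2 X1 X2 : psd W2 -> lam1 <= lam2 ->
  X1^T = X1 -> X2^T = X2 -> (forall v, qf X1 v <= qf X2 v) ->
  posdef (rS lam1 X1) ->
  posdef (rS lam2 X2) /\ forall v, qf (step lam1 X1) v <= qf (step lam2 X2) v.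
Proof.
move=> W0 le12 X1T X2T leX pS1; have quad := quad_mono W0 le12 leX.
have pS2 : posdef (rS lam2 X2).
  split; first exact: riccati_S_sym.
  move=> v v0; rewrite -/(qf _ _) qf_rS.
  apply: lt_le_trans (quad _); rewrite -qf_rS; exact: pS1.2.
split=> // v; rewrite (qf_step _ X2T) ?posdef_unitmx //.
apply: le_trans (quad _); rewrite qf_complete_square ?posdef_unitmx //.
by rewrite mulmxA state_feedback_mx mul1mx lerDl; exact: posdef_psd.
Qed.

Lemma riccati_pos lam X : posdef (Mt lam) -> X^T = X -> psd X ->
  posdef (rS lam X) /\ psd (step lam X).
Proof.
move=> pM XT X0.
have pS : posdef (rS lam X).
  split; first exact: riccati_S_sym.
  move=> v v0; rewrite -/(qf _ _) qf_rS qfD qf_mul.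
  apply: ltr_wpDr; first exact: X0.
  apply: pM.2; apply: contra v0 => /eqP e.
  by rewrite -(col_mxKd (0 : 'cV_n) v) e linear0.
split=> // v; rewrite qf_step ?posdef_unitmx // qfD qf_mul.
by rewrite addr_ge0 // (posdef_psd pM).
Qed.

(** Reversing time turns the backward recursion into iterates from [0] that do
    not depend on the horizon. *)
Lemma LambdaP H lam : Lambda H A B M W2 lam <->
  0 <= lam /\ forall k, (k < H)%N -> posdef (rS lam (iter k (step lam) 0)).
Proof.
split=> -[lam0 pS]; split=> // k kH; last first.
  by rewrite /S_ /P_; apply: pS; rewrite ltn_subrL /= (leq_ltn_trans _ kH).
have lt : (H - k.+1 < H)%N by rewrite ltn_subrL /= (leq_ltn_trans _ kH).
by have := pS _ lt; rewrite /S_ /P_ subnSK // subKn // ltnW.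
Qed.

Lemma Lambda_up H lam1 lam2 : psd W2 ->
  Lambda H A B M W2 lam1 -> lam1 <= lam2 -> Lambda H A B M W2 lam2.
Proof.
move=> W0 /LambdaP[lam0 pS] le12; apply/LambdaP.
split; first exact: le_trans le12.
have mono k : (k <= H)%N -> forall v,
    qf (iter k (step lam1) 0) v <= qf (iter k (step lam2) 0) v.
  elim: k => [//|k IH] kH; apply: (riccati_mono W0 le12 _ _ (IH (ltnW kH)) _).2.
  - exact: iter_step_sym.
  - exact: iter_step_sym.
  - exact: pS.
move=> k kH; apply: (riccati_mono W0 le12 _ _ (mono _ (ltnW kH)) _).1.
- exact: iter_step_sym.
- exact: iter_step_sym.
- exact: pS.
Qed.

Lemma Lambda_posdef H lam : 0 <= lam -> posdef (Mt lam) ->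
  Lambda H A B M W2 lam.
Proof.
move=> lam0 pM; apply/LambdaP; split=> // k _.
have p0 : psd (iter k (step lam) 0).
  elim: k => [v|k IH] /=; first by rewrite /qf mulmx0 mul0mx mxE.
  by apply: (riccati_pos pM _ IH).2; exact: iter_step_sym.
by apply: (riccati_pos pM _ p0).1; exact: iter_step_sym.
Qed.

End riccati_algebra.

(** * The Lagrangian cost of a sequence of second moments *)

Section cost_of_moments.
Context {R : realType} {n m : nat} (H : nat).
Context (A : 'M[R]_n) (B : 'M[R]_(n, m)) (Sw : 'M[R]_n).
Local Notation F := (row_mx A B).

(** What the second moments [E[z_t z_t^T]] of a causal policy have in common.
    The Lagrangian cost of a policy depends on nothing else, so the optimality
    argument is carried out on such sequences, without probability. Positive
    semidefiniteness is expressed by duality, the form in which it is used. *)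
Record moment_sequence (Z : nat -> 'M[R]_(n + m)) : Prop := MomentSequence {
  moments_ge0 : forall t W, (t < H)%N -> psd W -> 0 <= \tr (W *m Z t);
  moments_init : ulsubmx (Z 0) = 0;
  moments_next : forall t, (t.+1 < H)%N ->
    ulsubmx (Z t.+1) = F *m Z t *m F^T + Sw }.

Lemma tr_ul (Y : 'M[R]_n) (Z : 'M[R]_(n + m)) :
  \tr ((row_mx 1%:M 0)^T *m Y *m row_mx 1%:M 0 *m Z) = \tr (Y *m ulsubmx Z).
Proof.
rewrite -!mulmxA mxtrace_mulC -!mulmxA; congr (\tr (_ *m _)).
rewrite -{1}(submxK Z) tr_row_mx trmx1 trmx0 mul_block_col mul_row_col.
by rewrite mul0mx mul1mx !mulmx0 mulmx1 !addr0.
Qed.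

Lemma tr_mulD_eq d (a b a' b' Z : 'M[R]_d) : a + b = a' + b' ->
  \tr (a *m Z) + \tr (b *m Z) = \tr (a' *m Z) + \tr (b' *m Z).
Proof. by move=> E; rewrite -!linearD -!mulmxDl E. Qed.

Context (M W2 : 'M[R]_(n + m)) (MT : M^T = M) (W2T : W2^T = W2).
Local Notation Mt := (Mtilde M W2).

Definition noise_cost lam := \sum_(t < H) \tr (P_ H A B M W2 lam t.+1 *m Sw).

Definition residual_cost lam (Z : nat -> 'M[R]_(n + m)) :=
  \sum_(t < H) \tr ((residual_mx (K_ H A B M W2 lam t))^T *m S_ H A B M W2 lam t
                    *m residual_mx (K_ H A B M W2 lam t) *m Z t).

(** Completing the square at each stage, the terms [tr (P_t E[x_t x_t^T])]
    telescope along the state recursion; what is left is a noise cost, the same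
    for all policies, and the penalties of the deviations from the
    Riccati feedback. *)
Lemma cost_decomposition lam Z : Lambda H A B M W2 lam -> moment_sequence Z ->
  \tr (Mt lam *m \sum_(t < H) Z t) = noise_cost lam + residual_cost lam Z.
Proof.
move=> [_ pS] mZ; pose p t := P_ H A B M W2 lam t.
have pT t : (p t)^T = p t by exact: iter_step_sym.
(* the value at [H] stands for [tr (P_H X_H)], which is 0 as [P_H = 0]; the
   moments are not controlled at time [H] *)
pose f t := if (t < H)%N then \tr (p t *m ulsubmx (Z t)) else 0.
have stage t : (t < H)%N -> \tr (Mt lam *m Z t) =
    \tr (p t.+1 *m Sw) +
    \tr ((residual_mx (K_ H A B M W2 lam t))^T *m S_ H A B M W2 lam t
         *m residual_mx (K_ H A B M W2 lam t) *m Z t) + (f t - f t.+1).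
  move=> tH.
  have E : Mt lam + F^T *m p t.+1 *m F =
      (row_mx 1%:M 0)^T *m p t *m row_mx 1%:M 0
      + (residual_mx (K_ H A B M W2 lam t))^T *m S_ H A B M W2 lam t
        *m residual_mx (K_ H A B M W2 lam t).
    have -> : p t = riccati_step A B M W2 lam (p t.+1) by exact: P_backward.
    exact (complete_square A MT W2T (pT t.+1) (posdef_unitmx (pS t tH))).
  have {E} := tr_mulD_eq (Z t) E; rewrite tr_ul.
  have -> : \tr (F^T *m p t.+1 *m F *m Z t) = \tr (p t.+1 *m (F *m Z t *m F^T)).
    by rewrite -!mulmxA mxtrace_mulC !mulmxA.
  move/(canRL (addrK _)) ->; rewrite /f tH.
  set gap := \tr (_ *m residual_mx _ *m _).
  case: ltnP => tH1.
    by rewrite (moments_next mZ) // mulmxDr mxtraceD; ring.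
  have -> : p t.+1 = 0.
    by rewrite /p -(P_terminal H A B M W2 lam); congr P_; lia.
  by rewrite !mul0mx mxtrace0; ring.
rewrite mulmx_sumr linear_sum /=.
under eq_bigr => t _ do rewrite stage //.
rewrite !big_split /=.
have -> : \sum_(t < H) f t + \sum_(t < H) - f t.+1 = 0.
  rewrite -big_split /= -(big_mkord xpredT (fun t => f t - f t.+1)).
  rewrite -[LHS]opprK -sumrN; under eq_bigr => t _ do rewrite opprB.
  rewrite telescope_sumr // /f ltnn (moments_init mZ) mulmx0 mxtrace0 if_same.
  by rewrite subrr oppr0.
by rewrite addr0.
Qed.

Lemma residual_cost_ge0 lam Z : Lambda H A B M W2 lam -> moment_sequence Z ->
  0 <= residual_cost lam Z.
Proof.
move=> [_ pS] mZ; apply: sumr_ge0 => t _.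
by apply: (moments_ge0 mZ) => //; apply/psd_conj/posdef_psd/pS.
Qed.

Lemma residual_cost_feedback lam Z :
  (forall t, (t < H)%N -> let G := feedback_mx (K_ H A B M W2 lam t) in
    Z t = G *m ulsubmx (Z t) *m G^T) ->
  residual_cost lam Z = 0.
Proof.
move=> ZE; apply: big1 => t _; rewrite ZE //.
rewrite !mulmxA -(mulmxA _ (residual_mx _)) residual_feedback_mx.
by rewrite mulmx0 !mul0mx mxtrace0.
Qed.

End cost_of_moments.

(** * Independent and square integrable random variables *)

Section independence.
Context {d} {O : measurableType d} {R : realType} (Q : probability O R).
Local Open Scope ereal_scope.

(** The law of [(X, Y)] is the product of the laws of [X] and [Y] because they
    agree on rectangles; Fubini's theorem then factors the integral. *)
Lemma integral_indep_mul (X Y : {mfun O >-> R}) :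
  (forall A B : set R, measurable A -> measurable B ->
     Q (X @^-1` A `&` Y @^-1` B) = Q (X @^-1` A) * Q (Y @^-1` B)) ->
  Q.-integrable setT (EFin \o X) -> Q.-integrable setT (EFin \o Y) ->
  Q.-integrable setT (EFin \o (fun o => X o * Y o)%R) ->
  \int[Q]_o (X o * Y o)%:E = \int[Q]_o (X o)%:E * \int[Q]_o (Y o)%:E.
Proof.
move=> ind iX iY iXY.
have mXY : measurable_fun setT (fun o => (X o, Y o)).
  by apply: measurable_fun_pair; exact: measurable_funPT.
pose XY : {mfun O >-> (R * R)%type} := mfun_Sub (mem_set mXY).
pose f (z : (R * R)%type) := (z.1 * z.2)%:E.
have mf : measurable_fun setT f.
  by apply/measurable_EFinP; apply: measurable_funM.
have eqm S : measurable S ->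
    (distribution Q X \x distribution Q Y) S = distribution Q XY S.
  by move=> mS; apply: product_measure_unique => // A B; exact: ind.
have ifm : (distribution Q XY).-integrable setT f.
  by apply: integrable_pushforward => //; exact: measurable_funPT.
have ifp : (distribution Q X \x distribution Q Y).-integrable setT f.
  apply/integrableP; split=> //.
  rewrite (eq_measure_integral (distribution Q XY)); last first.
    by move=> S mS _; exact: eqm.
  by have /integrableP[] := ifm.
have -> : \int[Q]_o (X o * Y o)%:E = \int[distribution Q XY]_z f z.
  by rewrite integral_distribution.
rewrite (eq_measure_integral (distribution Q X \x distribution Q Y));
  last by move=> S mS _; exact/esym/eqm.
rewrite -integral12_prod_meas1 //= /fubini_F /f /=.
have idX : (distribution Q X).-integrable setT EFin.
  by apply: integrable_pushforward => //; exact: measurable_funPT.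
have idY : (distribution Q Y).-integrable setT EFin.
  by apply: integrable_pushforward => //; exact: measurable_funPT.
have eY : \int[distribution Q Y]_y y%:E = \int[Q]_o (Y o)%:E.
  by rewrite integral_distribution.
have eX : \int[distribution Q X]_y y%:E = \int[Q]_o (X o)%:E.
  by rewrite integral_distribution.
under eq_integral => x _.
  under eq_integral => y _ do rewrite EFinM.
  rewrite integralZl // eY; over.
have fY := integrable_fin_num measurableT iY.
by rewrite -(fineK fY) integralZr // eX.
Qed.

End independence.

Section second_moments.
Context {d} {O : measurableType d} {R : realType} (Q : probability O R).

Lemma sqr_integrable_Lfun2 (f : O -> R) : measurable_fun setT f ->
  Q.-integrable setT (EFin \o (fun o => f o ^+ 2)) -> f \in Lfun Q 2%:E.
Proof.
move=> mf /integrableP[_ fi]; rewrite inE; apply/andP; split; rewrite inE //=.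
rewrite /finite_norm unlock poweR_lty //.
move: fi; congr (_ < _)%E; apply: eq_integral => o _ /=.
by rewrite powR_mulrn // normrX.
Qed.

Lemma Lfun2_measurable (f : O -> R) :
  f \in Lfun Q 2%:E -> measurable_fun setT f.
Proof. by rewrite inE => /andP[/[!inE]]. Qed.

Lemma Lfun2_mul_integrable (f g : O -> R) :
  f \in Lfun Q 2%:E -> g \in Lfun Q 2%:E ->
  Q.-integrable setT (EFin \o (fun o => f o * g o)).
Proof. by move=> f2 g2; apply/Lfun1_integrable; exact: Lfun2_mul_Lfun1. Qed.

Lemma Lfun2_integrable (f : O -> R) :
  f \in Lfun Q 2%:E -> Q.-integrable setT (EFin \o f).
Proof.
move=> f2; apply/Lfun1_integrable/Lfun_subset12 => //.
exact: fin_num_measure.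
Qed.

Lemma Lfun2_sum (I : Type) (s : seq I) (a : I -> R) (f : I -> O -> R) :
  (forall i, f i \in Lfun Q 2%:E) ->
  (fun o => \sum_(i <- s) a i * f i o) \in Lfun Q 2%:E.
Proof.
move=> f2.
rewrite (_ : (fun o => _) = \sum_(i <- s) a i *: (f i : O -> R)); last first.
  by apply/funext => o; rewrite fct_sumE.
elim/big_ind : _ => [|g h gL hL|i _].
- exact: Lfun_cst.
- exact: (Lfun_addr_closed Q (lee1n 2)).2.
- by rewrite -[a i *: _]addr0; apply: (Lfun_submod_closed Q (lee1n 2)).2 => //;
    exact: Lfun_cst.
Qed.

Lemma Lfun2_add (f g : O -> R) : f \in Lfun Q 2%:E -> g \in Lfun Q 2%:E ->
  (fun o => f o + g o) \in Lfun Q 2%:E.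
Proof. exact: (Lfun_addr_closed Q (lee1n 2)).2. Qed.

Lemma Rintegral_lin_sum (I : Type) (s : seq I) (a : I -> R) (f : I -> O -> R) :
  (forall i, Q.-integrable setT (EFin \o f i)) ->
  \int[Q]_o (\sum_(i <- s) a i * f i o) = \sum_(i <- s) a i * \int[Q]_o f i o.
Proof.
move=> fi; elim: s => [|i s IH].
  under eq_Rintegral do rewrite big_nil.
  by rewrite big_nil Rintegral_cst // mul0r.
under eq_Rintegral do rewrite big_cons.
have aI j : Q.-integrable setT (fun o => (a j * f j o)%:E).
  by have := integrableZl measurableT (a j) (fi j); apply: eq_integrable.
rewrite RintegralD //; last 2 first.
- exact: aI.
- rewrite (_ : _ \o _ = fun o => (\sum_(j <- s) (a j * f j o)%:E)%E).
    exact: integrable_sum.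
  by apply/funext => o /=; rewrite sumEFin.
by rewrite RintegralZl // IH big_cons.
Qed.

Definition vecL2 p (f : O -> 'cV[R]_p) :=
  forall i, (fun o => f o i 0) \in Lfun Q 2%:E.

(** The matrix [E[f g^T]]. *)
Definition crossmx p q (f : O -> 'cV[R]_p) (g : O -> 'cV[R]_q) : 'M[R]_(p, q) :=
  \matrix_(i, j) \int[Q]_o (f o i 0 * g o j 0).

Lemma crossmx_tr p q (f : O -> 'cV[R]_p) (g : O -> 'cV[R]_q) :
  (crossmx f g)^T = crossmx g f.
Proof.
apply/matrixP => i j; rewrite !mxE; apply: eq_Rintegral => o _.
by rewrite mulrC.
Qed.

Lemma vecL2_mul p q (C : 'M[R]_(p, q)) f : vecL2 f -> vecL2 (fun o => C *m f o).
Proof.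
move=> fL i; under eq_fun do rewrite mxE; exact: Lfun2_sum.
Qed.

Lemma vecL2_add p (f g : O -> 'cV[R]_p) :
  vecL2 f -> vecL2 g -> vecL2 (fun o => f o + g o).
Proof. by move=> fL gL i; under eq_fun do rewrite mxE; exact: Lfun2_add. Qed.

Lemma crossmx_mull p q r (C : 'M[R]_(p, q)) f (g : O -> 'cV[R]_r) :
  vecL2 f -> vecL2 g -> crossmx (fun o => C *m f o) g = C *m crossmx f g.
Proof.
move=> fL gL; apply/matrixP => i j; rewrite !mxE.
under eq_Rintegral => o _.
  rewrite mxE mulr_suml; under eq_bigr => k _ do rewrite -mulrA; over.
rewrite Rintegral_lin_sum => [|k]; last exact: Lfun2_mul_integrable.
by apply: eq_bigr => k _; rewrite mxE.
Qed.

Lemma crossmx_addl p q (f f' : O -> 'cV[R]_p) (g : O -> 'cV[R]_q) :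
  vecL2 f -> vecL2 f' -> vecL2 g ->
  crossmx (fun o => f o + f' o) g = crossmx f g + crossmx f' g.
Proof.
move=> fL fL' gL; apply/matrixP => i j; rewrite !mxE.
under eq_Rintegral => o _ do rewrite mxE mulrDl.
by rewrite RintegralD //; exact: Lfun2_mul_integrable.
Qed.

Lemma crossmx_mulr p q r (C : 'M[R]_(p, q)) f (g : O -> 'cV[R]_r) :
  vecL2 f -> vecL2 g -> crossmx g (fun o => C *m f o) = crossmx g f *m C^T.
Proof.
by move=> fL gL; rewrite -crossmx_tr crossmx_mull // trmx_mul crossmx_tr.
Qed.

Lemma crossmx_addr p q (f f' : O -> 'cV[R]_p) (g : O -> 'cV[R]_q) :
  vecL2 f -> vecL2 f' -> vecL2 g ->
  crossmx g (fun o => f o + f' o) = crossmx g f + crossmx g f'.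
Proof.
by move=> fL fL' gL; rewrite -crossmx_tr crossmx_addl // linearD /= !crossmx_tr.
Qed.

Lemma crossmx_mul p q (C : 'M[R]_(p, q)) f : vecL2 f ->
  crossmx (fun o => C *m f o) (fun o => C *m f o) = C *m crossmx f f *m C^T.
Proof.
move=> fL; have CfL := vecL2_mul C fL.
by rewrite crossmx_mull // crossmx_mulr // mulmxA.
Qed.

Lemma crossmx_psd p (f : O -> 'cV[R]_p) W : vecL2 f -> psd W ->
  0 <= \tr (W *m crossmx f f).
Proof.
move=> fL W0.
have -> : \tr (W *m crossmx f f) = \int[Q]_o qf W (f o); last first.
  by apply: Rintegral_ge0 => o _; exact: W0.
transitivity (\sum_(ij : 'I_p * 'I_p) W ij.1 ij.2 *
                \int[Q]_o (f o ij.1 0 * f o ij.2 0)).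
  rewrite -(pair_bigA _ (fun i j => W i j * \int[Q]_o (f o i 0 * f o j 0))) /=.
  apply: eq_bigr => i _; rewrite mxE; apply: eq_bigr => j _.
  by rewrite -crossmx_tr !mxE.
rewrite -Rintegral_lin_sum => [|ij]; last exact: Lfun2_mul_integrable.
apply: eq_Rintegral => o _; rewrite qfE.
by rewrite -(pair_bigA _ (fun i j => W i j * (f o i 0 * f o j 0))).
Qed.

End second_moments.

(** * A disturbance is independent of the past *)

Section causality.
Context {dT : measure_display} {T : measurableType dT} {R : realType}.
Context {n m : nat}.
Context (P : probability T R) (H : nat) (A : 'M[R]_n) (B : 'M[R]_(n, m)).
Context (w : nat -> T -> 'cV[R]_n) (pi : policy R n m).
Local Notation Q := (P \x seed_law pi)%E.

Lemma measurable_mulmx d (O : measurableType d) p q (C : 'M[R]_(p, q))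
    (f : O -> 'cV[R]_q) :
  measurable_fun setT f -> measurable_fun setT (fun o => C *m f o).
Proof.
move=> /measurable_fun_mxP mf; apply/measurable_fun_mxP => i j.
under eq_fun do rewrite mxE.
by apply: measurable_sum => k; apply: measurable_funM.
Qed.

Lemma measurable_addmx d (O : measurableType d) p q (f g : O -> 'M[R]_(p, q)) :
  measurable_fun setT f -> measurable_fun setT g ->
  measurable_fun setT (fun o => f o + g o).
Proof.
move=> /measurable_fun_mxP mf /measurable_fun_mxP mg.
apply/measurable_fun_mxP => i j; under eq_fun do rewrite mxE.
exact: measurable_funD.
Qed.

(** Measurability of the closed loop is established after composition with a map
    [f] from an arbitrary measurable space. The identity from the product space
    gives measurability in the usual sense; the identity from the same set with
    a smaller sigma-algebra, where only past disturbances and the seed are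
    measurable, expresses causality. *)
Section observer.
Context {d} {O : measurableType d} (f : O -> T * seed pi).
Hypothesis mseed : measurable_fun setT (fun o => (f o).2).

Let measurable_act_comp t :
  measurable_fun setT (fun o => states A B w t (f o)) ->
  measurable_fun setT (fun o => act pi t (f o).2 (states A B w t (f o))).
Proof.
move=> ms.
exact: (measurableT_comp (@measurable_act _ _ _ pi t)
          (measurable_fun_pair mseed ms)).
Qed.

Lemma measurable_states t :
  (forall s, (s < t)%N -> measurable_fun setT (fun o => w s (f o).1)) ->
  measurable_fun setT (fun o => states A B w t (f o)).
Proof.
elim: t => [_|t IH mw]; first exact: measurable_cst.
have {}IH := IH (fun s st => mw s (ltnW st)).
apply/measurable_fun_tnthP => i; rewrite /comp /=.
case: (ltnP i t.+1) => it.
  have E o : tnth (states A B w t.+1 (f o)) i =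
      tnth (states A B w t (f o)) (Ordinal it).
    by rewrite !(tnth_nth 0) /= nth_rcons size_tuple it.
  under eq_fun do rewrite E.
  exact: (measurableT_comp (measurable_tnth _) IH).
have {it} it : i = t.+1 :> nat by apply/eqP; rewrite eqn_leq it -ltnS ltn_ord.
have E o : tnth (states A B w t.+1 (f o)) i =
    A *m tnth (states A B w t (f o)) ord_max
    + B *m act pi t (f o).2 (states A B w t (f o)) + w t (f o).1.
  by rewrite [LHS](tnth_nth 0) /= nth_rcons size_tuple it ltnn eqxx.
under eq_fun do rewrite E.
apply: measurable_addmx; last exact: mw.
apply: measurable_addmx; apply: measurable_mulmx.
  exact: (measurableT_comp (measurable_tnth _) IH).
exact: measurable_act_comp.
Qed.

Lemma measurable_zvec t :
  (forall s, (s < t)%N -> measurable_fun setT (fun o => w s (f o).1)) ->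
  measurable_fun setT (fun o => zvec A B w t (f o)).
Proof.
move=> /measurable_states ms; apply/measurable_fun_mxP => i j.
case: (split_ordP i) => k ->.
  under eq_fun do rewrite col_mxEu.
  move: k j; apply/measurable_fun_mxP.
  exact: (measurableT_comp (measurable_tnth _) ms).
under eq_fun do rewrite col_mxEd.
by move: k j; apply/measurable_fun_mxP; exact: measurable_act_comp.
Qed.

End observer.

(** A pi-system that generates the sigma-algebra of the seed and of the
    disturbances before time [t]. *)
Definition history t : set (set (T * seed pi)) :=
  [set C | exists E D, [/\ forall s, measurable (E s), measurable D &
    C = (\bigcap_(s in `I_t) w s @^-1` E s) `*` D]].

Hypothesis w_iid : iid P H w.

Let measurable_w s E : (s < H)%N -> measurable E -> measurable (w s @^-1` E).
Proof.
by move=> sH mE; rewrite -[X in measurable X]setTI; exact: w_iid.1.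
Qed.

Let measurable_hist t E : (t <= H)%N -> (forall s, measurable (E s)) ->
  measurable (\bigcap_(s in `I_t) w s @^-1` E s).
Proof.
move=> tH mE; apply: bigcap_measurableType => s st.
by apply: measurable_w => //; exact: leq_trans st tH.
Qed.

Lemma history_measurable t : (t <= H)%N -> history t `<=` measurable.
Proof.
move=> tH _ [E [D [mE mD ->]]]; apply: measurableX => //.
exact: measurable_hist.
Qed.

Lemma history_setI t : setI_closed (history t).
Proof.
move=> _ _ [E [D [mE mD ->]]] [E' [D' [mE' mD' ->]]].
exists (fun s => E s `&` E' s), (D `&` D'); split.
- by move=> s; exact: measurableI.
- exact: measurableI.
- rewrite -setXI; congr (_ `*` _); apply/seteqP; split=> [x [h h'] s st|x h].
    by split; [exact: h|exact: h'].
  by split=> s st; have [] := h s st.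
Qed.

(** Only the events of indices below [t] matter: the others are set to the whole
    space in the product rule over the full horizon. *)
Lemma prob_prefix t E : (t <= H)%N -> (forall s, measurable (E s)) ->
  (P (\bigcap_(s in `I_t) w s @^-1` E s) = \prod_(s < t) P (w s @^-1` E s))%E.
Proof.
move=> tH mE; pose E' s := if (s < t)%N then E s else setT.
have mE' s : measurable (E' s) by rewrite /E'; case: ifP.
have := w_iid.2.1 E' mE'.
rewrite (_ : \bigcap_(s in `I_H) _ = \bigcap_(s in `I_t) w s @^-1` E s).
  move=> ->; rewrite (big_ord_widen _ (fun s => P (w s @^-1` E s)) tH).
  rewrite [RHS]big_mkcond; apply: eq_bigr => s _; rewrite /E'.
  by case: ifP => // _; rewrite preimage_setT probability_setT.
apply/seteqP; split=> x xE s /= st.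
  by have := xE s (leq_trans st tH); rewrite /E' st.
by rewrite /E'; case: ifP => // /xE.
Qed.

Lemma indep_prefix t E F : (t < H)%N -> (forall s, measurable (E s)) ->
  measurable F ->
  (P ((\bigcap_(s in `I_t) w s @^-1` E s) `&` w t @^-1` F) =
   P (\bigcap_(s in `I_t) w s @^-1` E s) * P (w t @^-1` F))%E.
Proof.
move=> tH mE mF; pose E' s := if (s < t)%N then E s else F.
have mE' s : measurable (E' s) by rewrite /E'; case: ifP.
rewrite (_ : _ `&` _ = \bigcap_(s in `I_t.+1) w s @^-1` E' s); last first.
  apply/seteqP; split=> x.
    move=> [xE xF] s /=; rewrite ltnS leq_eqVlt /E' => /predU1P[->|st].
      by rewrite ltnn.
    by rewrite st; exact: xE.
  move=> xE; split=> [s /= st|].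
    by have := xE s (ltnW st); rewrite /E' st.
  by have := xE t (ltnSn t); rewrite /E' ltnn.
rewrite (prob_prefix tH mE') (prob_prefix (ltnW tH) mE) big_ord_recr /=.
rewrite {2}/E' ltnn; congr (_ * _)%E.
by apply: eq_bigr => s _; rewrite /E' ltn_ord.
Qed.

(** For a fixed disturbance event both sides are finite measures in [C]; they
    agree on the pi-system [history t], hence on the generated sigma-algebra. *)
Lemma noise_indep_history t F C : (t < H)%N -> measurable F ->
  <<s history t >> C ->
  (Q (C `&` (fun o => w t o.1) @^-1` F) =  Q C * P (w t @^-1` F))%E.
Proof.
move=> tH mF; set D := _ @^-1` F.
have DE : D = (w t @^-1` F) `*` setT.
  by apply/seteqP; split=> [y|y []].
have mwF : measurable (w t @^-1` F) by exact: measurable_w.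
have mD : measurable D by rewrite DE; exact: measurableX.
have p0 : 0 <= fine (P (w t @^-1` F)) by rewrite fine_ge0.
move: C; suff CE : forall C, <<s history t >> C ->
    mrestr Q mD C = mscale (NngNum p0) Q C.
  move=> C /CE; rewrite /mrestr /mscale /= => ->.
  by rewrite fineK ?fin_num_measure // muleC.
apply: (g_sigma_algebra_measure_unique (history t) _ (fun=> setT)).
- exact: history_measurable (ltnW tH).
- move=> _; exists (fun=> setT), setT; split=> //.
  by apply/seteqP; split=> // o _; split.
- exact: bigcup_const.
- exact: history_setI.
- move=> _ [E [G [mE mG ->]]]; set C := _ `*` G.
  suff : (Q (C `&` D) = (fine (P (w t @^-1` F)))%:E * Q C)%E by [].
  have mE' : measurable (\bigcap_(s in `I_t) w s @^-1` E s).
    exact: measurable_hist (ltnW tH) mE.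
  rewrite DE -setXI setIT !product_measure1E //; last exact: measurableI.
  transitivity (P (\bigcap_(s in `I_t) w s @^-1` E s) * P (w t @^-1` F)
                * seed_law pi G)%E.
    by congr (_ * _)%E; exact: indep_prefix.
  by rewrite fineK ?fin_num_measure // muleAC muleC.
- move=> _; rewrite /= /mrestr setTI.
  by rewrite (le_lt_trans (probability_le1 _ _)) // ltry.
Qed.

End causality.

(** * Second moments along the closed loop *)

Section closed_loop_moments.
Context {dT : measure_display} {T : measurableType dT} {R : realType}.
Context {n m : nat}.
Context (P : probability T R) (H : nat) (A : 'M[R]_n) (B : 'M[R]_(n, m)).
Context (w : nat -> T -> 'cV[R]_n) (Sw : 'M[R]_n).
Hypotheses (w_iid : iid P H w) (w_mean : zero_mean P H w).
Hypothesis w_cov : has_covariance P H w Sw.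

Section any_policy.
Context (pi : policy R n m).
Local Notation Q := (P \x seed_law pi)%E.
Local Notation O := (T * seed pi)%type.
Local Notation noise t := (fun o : O => w t o.1).
Local Notation z := (@zvec _ _ _ _ _ A B w pi).
Local Notation x := (@state _ _ _ _ _ A B w pi).

Lemma integral_seed_cst (c : R) : (\int[seed_law pi]_y c%:E = c%:E)%E.
Proof.
rewrite integral_cst // -[RHS]mule1; congr (_ * _)%E.
exact: probability_setT.
Qed.

Lemma integrable_fst (g : T -> R) : P.-integrable setT (EFin \o g) ->
  Q.-integrable setT (EFin \o (fun o : O => g o.1)).
Proof.
move=> gi; have mg : measurable_fun setT g.
  exact/measurable_EFinP/(measurable_int P).
apply/integrable12ltyP.
  by apply/measurable_EFinP; exact: measurableT_comp.
rewrite (eq_integral (fun t => `|(g t)%:E|)%E) => [|t _]; last first.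
  exact: (integral_seed_cst `|g t|).
by have /integrableP[] := gi.
Qed.

Lemma Rintegral_fst (g : T -> R) : P.-integrable setT (EFin \o g) ->
  \int[Q]_o g o.1 = \int[P]_t g t.
Proof.
move=> /integrable_fst gi; rewrite /Rintegral -(integral12_prod_meas1 gi).
congr fine; apply: eq_integral => t _.
exact: (integral_seed_cst (g t)).
Qed.

Lemma noise_measurable t : (t < H)%N -> measurable_fun setT (noise t).
Proof. by move=> tH; apply: measurableT_comp => //; exact: w_iid.1. Qed.

Lemma noise_vecL2 t : (t < H)%N -> vecL2 Q (noise t).
Proof.
move=> tH i; apply: sqr_integrable_Lfun2.
  by have /measurable_fun_mxP mw := noise_measurable tH; exact: mw.
have [wi _] := w_cov i i tH.
under [X in _.-integrable _ (EFin \o X)]eq_fun do rewrite expr2.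
exact: integrable_fst (fun t' => w t t' i 0 * w t t' i 0) wi.
Qed.

Lemma noise_covariance t : (t < H)%N -> crossmx Q (noise t) (noise t) = Sw.
Proof.
move=> tH; apply/matrixP => i j; rewrite mxE.
have [wi wE] := w_cov i j tH.
by rewrite (Rintegral_fst wi) /Rintegral wE.
Qed.

Local Notation past t := (g_sigma_algebraType (@history _ T R n m w pi t)).

Lemma past_measurable t :
  measurable_fun setT (fun o : past t => z t o).
Proof.
apply: (@measurable_zvec _ _ _ _ _ _ _ _ _ _ (past t) id).
  move=> _ D mD; rewrite setTI; apply: sub_sigma_algebra.
  exists (fun=> setT), D; split=> //.
  by apply/seteqP; split=> [y yD|y []].
move=> s st _ F mF; rewrite setTI; apply: sub_sigma_algebra.
exists (fun s' => if s' == s then F else setT), setT; split=> //.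
  by move=> s'; case: ifP.
apply/seteqP; split=> [y yF|y [/(_ s st)]]; last by rewrite eqxx.
by split=> // s' _; have [->|] := eqVneq s' s.
Qed.

(** The current disturbance has zero mean and is independent of the past, so it
    is uncorrelated with any past quantity. *)
Lemma noise_orth t (g : O -> R) i : (t < H)%N ->
  measurable_fun setT (g : past t -> R) -> g \in Lfun Q 2%:E ->
  \int[Q]_o (g o * w t o.1 i 0) = 0.
Proof.
move=> tH mg gL; have wL := noise_vecL2 tH i.
pose X : {mfun O >-> R} := mfun_Sub (mem_set (Lfun2_measurable gL)).
pose Y : {mfun O >-> R} := mfun_Sub (mem_set (Lfun2_measurable wL)).
rewrite /Rintegral.
have := @integral_indep_mul _ _ _ Q X Y.
rewrite /X /Y /= => ->.
- have [wi w0] := w_mean i tH.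
  have fY := integrable_fin_num measurableT (Lfun2_integrable wL).
  rewrite [X in (_ * X)%E](_ : _ = 0%E) ?mule0 // -(fineK fY); congr EFin.
  by have := Rintegral_fst wi; rewrite /Rintegral w0.
- move=> C D mC mD.
  have mF : measurable [set v : 'cV[R]_n | D (v i 0)].
    have := (@measurable_fun_mxP _ 'cV[R]_n R n 1 id).1
      (@measurable_id _ _ _) i 0.
    by move=> /(_ measurableT D mD); rewrite setTI.
  have gC : <<s @history _ T R n m w pi t >> (g @^-1` C).
    by have := mg measurableT C mC; rewrite setTI.
  have e := noise_indep_history w_iid tH mF gC.
  rewrite [LHS]e; congr (_ * _)%E.
  have := noise_indep_history w_iid tH mF (@measurableT _ (past t)).
  by rewrite setTI [X in (X * _)%E]probability_setT mul1e => <-.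
- exact: Lfun2_integrable.
- exact: Lfun2_integrable.
- exact: Lfun2_mul_integrable.
Qed.

Lemma state_next t o : x t.+1 o = row_mx A B *m z t o + w t o.1.
Proof.
rewrite /state (tnth_nth 0) /= nth_rcons size_tuple ltnn eqxx.
by rewrite mul_row_col.
Qed.

Lemma state0 o : x 0 o = 0.
Proof. by rewrite /state (tnth_nth 0). Qed.

Definition second_moment t := crossmx Q (z t) (z t).

Lemma ul_second_moment t : ulsubmx (second_moment t) = crossmx Q (x t) (x t).
Proof.
apply/matrixP => i j; rewrite !mxE; apply: eq_Rintegral => o _.
by rewrite !col_mxEu.
Qed.

Hypothesis pi_fin : Pi P H A B w pi.

Lemma zvec_vecL2 t : (t < H)%N -> vecL2 Q (z t).
Proof.
move=> tH i; apply: sqr_integrable_Lfun2; last exact: pi_fin.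
have mz : measurable_fun setT (z t).
  apply: (@measurable_zvec _ _ _ _ _ _ _ _ _ _ _ id) => [|s st].
    exact: measurable_snd.
  exact: noise_measurable (ltn_trans st tH).
by move/measurable_fun_mxP in mz; exact: mz.
Qed.

(** The cross terms of [x_{t+1} = (A x_t + B u_t) + w_t] vanish by
    orthogonality of the noise. *)
Lemma policy_moment_sequence : moment_sequence H A B Sw second_moment.
Proof.
split=> [t W tH W0||t tH].
- exact: crossmx_psd (zvec_vecL2 tH) W0.
- rewrite ul_second_moment; apply/matrixP => i j; rewrite !mxE.
  under eq_Rintegral do rewrite state0 mxE mul0r.
  by rewrite Rintegral_cst // mul0r mxE.
have tH' := ltnW tH; have zL := zvec_vecL2 tH'; have wL := noise_vecL2 tH'.
have FzL := vecL2_mul (row_mx A B) zL.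
rewrite ul_second_moment.
rewrite (_ : x t.+1 = fun o => row_mx A B *m z t o + w t o.1); last first.
  by apply/funext => o; exact: state_next.
have zw : crossmx Q (z t) (noise t) = 0.
  apply/matrixP => i j; rewrite !mxE; apply: noise_orth => //.
  by have /measurable_fun_mxP mz := @past_measurable t; exact: mz.
rewrite crossmx_addl ?crossmx_addr //; last exact: vecL2_add.
rewrite crossmx_mul // noise_covariance // crossmx_mull // zw mulmx0 addr0.
rewrite crossmx_mulr // -[crossmx _ (noise t) _]crossmx_tr zw.
by rewrite trmx0 mul0mx add0r.
Qed.

Lemma Sigma_policy : Sigma P H A B w pi = \sum_(t < H) second_moment t.
Proof.
apply/matrixP => i j; rewrite !mxE summxE.
under eq_Rintegral => o _.
  rewrite summxE; under eq_bigr => t _.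
    rewrite mxE big_ord1 -[_ * _]mul1r; rewrite [_^T _ _]mxE; over.
  over.
rewrite Rintegral_lin_sum => [|t]; last first.
  by apply: Lfun2_mul_integrable; exact: zvec_vecL2.
by apply: eq_bigr => t _; rewrite mul1r mxE.
Qed.

End any_policy.

Section linear_feedback.
Context (M W2 : 'M[R]_(n + m)) (lam : R).
Local Notation pi := (feedback H A B M W2 lam).
Local Notation Q := (P \x seed_law pi)%E.

Lemma zvec_feedback t o :
  zvec A B w t o =
  feedback_mx (K_ H A B M W2 lam t) *m state A B w (pi := pi) t o.
Proof. by rewrite /zvec mul_col_mx mul1mx. Qed.

Lemma feedback_state_vecL2 t : (t < H)%N -> vecL2 Q (state A B w (pi := pi) t).
Proof.
elim: t => [_ i|t IH tH].
  under eq_fun do rewrite state0 mxE; exact: Lfun_cst.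
rewrite (_ : state A B w t.+1 = fun o =>
    (row_mx A B *m feedback_mx (K_ H A B M W2 lam t))
    *m state A B w (pi := pi) t o
    + w t o.1).
  apply: vecL2_add; last exact: noise_vecL2 (ltnW tH).
  exact: vecL2_mul (IH (ltnW tH)).
by apply/funext => o; rewrite state_next zvec_feedback mulmxA.
Qed.

Lemma feedback_Pi : Pi P H A B w pi.
Proof.
move=> t i tH; apply: Lfun2_integrable_sqr.
under eq_fun do rewrite zvec_feedback.
exact: vecL2_mul (feedback_state_vecL2 tH) i.
Qed.

Lemma second_moment_feedback t : (t < H)%N ->
  let G := feedback_mx (K_ H A B M W2 lam t) in
  second_moment pi t = G *m ulsubmx (second_moment pi t) *m G^T.
Proof.
move=> tH G; rewrite ul_second_moment /second_moment.
rewrite (_ : zvec A B w t = fun o => G *m state A B w (pi := pi) t o).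
  exact: crossmx_mul (feedback_state_vecL2 tH).
by apply/funext => o; exact: zvec_feedback.
Qed.

End linear_feedback.

End closed_loop_moments.

(** * Continuity in the multiplier *)

Section entrywise_continuity.
Context {R : realType} (l : R).

Definition cont_at (f : R -> R) := f @ l --> f l.

Lemma cont_cst (a : R) : cont_at (fun=> a).
Proof. exact: cvg_cst. Qed.

Lemma contD f g : cont_at f -> cont_at g -> cont_at (fun t => f t + g t).
Proof. exact: cvgD. Qed.

Lemma contM f g : cont_at f -> cont_at g -> cont_at (fun t => f t * g t).
Proof. exact: cvgM. Qed.

Lemma contN f : cont_at f -> cont_at (fun t => - f t).
Proof. exact: cvgN. Qed.

Lemma cont_lt f c : cont_at f -> f l < c -> \forall t \near l, f t < c.
Proof. by move=> fc fl; exact: (cvgr_lt _ fc). Qed.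

Definition mx_continuous p q (f : R -> 'M[R]_(p, q)) :=
  forall i j, cont_at (fun t => f t i j).

Lemma continuous_sum_at (I : Type) (r : seq I) (F : I -> R -> R) :
  (forall i, cont_at (F i)) ->
  cont_at (fun t => \sum_(i <- r) F i t).
Proof.
move=> Fc; elim: r => [|i r IH].
  by under eq_fun do rewrite big_nil; exact: cont_cst.
under eq_fun do rewrite big_cons.
exact: contD (Fc i) IH.
Qed.

Lemma continuous_prod_at (I : Type) (r : seq I) (F : I -> R -> R) :
  (forall i, cont_at (F i)) ->
  cont_at (fun t => \prod_(i <- r) F i t).
Proof.
move=> Fc; elim: r => [|i r IH].
  by under eq_fun do rewrite big_nil; exact: cont_cst.
under eq_fun do rewrite big_cons.
exact: contM (Fc i) IH.
Qed.

Lemma mxc_cst p q (C : 'M[R]_(p, q)) : mx_continuous (fun=> C).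
Proof. by move=> i j; exact: cont_cst. Qed.

Lemma mxc_add p q (f g : R -> 'M[R]_(p, q)) :
  mx_continuous f -> mx_continuous g -> mx_continuous (fun t => f t + g t).
Proof.
move=> fc gc i j; under eq_fun do rewrite mxE; exact: contD.
Qed.

Lemma mxc_opp p q (f : R -> 'M[R]_(p, q)) :
  mx_continuous f -> mx_continuous (fun t => - f t).
Proof. by move=> fc i j; under eq_fun do rewrite mxE; exact: contN. Qed.

Lemma mxc_mul p q r (f : R -> 'M[R]_(p, q)) (g : R -> 'M[R]_(q, r)) :
  mx_continuous f -> mx_continuous g -> mx_continuous (fun t => f t *m g t).
Proof.
move=> fc gc i j; under eq_fun do rewrite mxE.
by apply: continuous_sum_at => k; exact: contM.
Qed.

Lemma mxc_tr p q (f : R -> 'M[R]_(p, q)) :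
  mx_continuous f -> mx_continuous (fun t => (f t)^T).
Proof. by move=> fc i j; under eq_fun do rewrite mxE; exact: fc. Qed.

Lemma mxc_sum p q (I : Type) (r : seq I) (f : I -> R -> 'M[R]_(p, q)) :
  (forall i, mx_continuous (f i)) ->
  mx_continuous (fun t => \sum_(i <- r) f i t).
Proof.
move=> fc i j; under eq_fun do rewrite summxE.
by apply: continuous_sum_at => k; exact: fc.
Qed.

Lemma mxc_trace p (f : R -> 'M[R]_p) :
  mx_continuous f -> cont_at (fun t => \tr (f t)).
Proof. by move=> fc; apply: continuous_sum_at => i; exact: fc. Qed.

Lemma continuous_det p (f : R -> 'M[R]_p) :
  mx_continuous f -> cont_at (fun t => \det (f t)).
Proof.
move=> fc; apply: continuous_sum_at => s.
apply: (@contM (fun=> _)); first exact: cont_cst.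
by apply: continuous_prod_at => i; exact: fc.
Qed.

(** [invmx] is the identity off the invertible matrices, so its continuity is
    read from the adjugate formula, valid near a point where the determinant
    does not vanish. *)
Lemma mxc_invmx p (f : R -> 'M[R]_p) : f l \in unitmx ->
  mx_continuous f -> mx_continuous (fun t => invmx (f t)).
Proof.
move=> fl fc i j.
have dc := continuous_det fc.
have d0 : \det (f l) != 0 by rewrite -unitfE -unitmxE.
have near_unit : \forall t \near l, f t \in unitmx.
  have : \forall t \near l, \det (f t) != 0 by exact: cvgr_neq0 dc d0.
  by apply: filterS => t; rewrite unitmxE unitfE.
have ac : cont_at (fun t => (\det (f t))^-1 * (\adj (f t)) i j).
  apply: contM; first exact: cvgV.
  under eq_fun do rewrite mxE.
  apply: (@contM (fun=> _)); first exact: cont_cst.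
  apply: continuous_det => i' j'.
  by under eq_fun do rewrite !mxE; exact: fc.
have E t : f t \in unitmx ->
    invmx (f t) i j = (\det (f t))^-1 * (\adj (f t)) i j.
  by move=> ft; rewrite /invmx ft mxE.
rewrite /cont_at E //.
apply: cvg_trans ac; apply: near_eq_cvg.
by apply: filterS near_unit => t /E.
Qed.

(** Coercivity with constant [e] survives, with a smaller constant, any
    perturbation of the entries by less than [e] in total. *)
Lemma posdef_near p (f : R -> 'M[R]_p) : (forall t, (f t)^T = f t) ->
  mx_continuous f -> posdef (f l) -> \forall t \near l, posdef (f t).
Proof.
move=> fT fc /posdef_coercive[e e0 fe].
pose D t := norm_sum (f t - f l).
have Dc : cont_at D.
  apply: continuous_sum_at => i; apply: continuous_sum_at => j.
  under eq_fun do rewrite !mxE.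
  apply: cvg_norm; apply: contD; first exact: fc.
  exact: cont_cst.
have D0 : D l = 0.
  rewrite /D subrr; apply: big1 => i _; apply: big1 => j _.
  by rewrite mxE normr0.
have : \forall t \near l, D t < e by apply: cont_lt => //; rewrite D0.
apply: filterS => t te; apply/posdefP; first exact: fT.
exists (e - D t); first by rewrite subr_gt0.
move=> v; have := fe v; have := qf_bound (f t - f l) v.
rewrite qfD qfN ler_norml -/(D t) => /andP[h1 _] h2.
rewrite mulrBl; lra.
Qed.

End entrywise_continuity.

Section riccati_continuity.
Context {R : realType} {n m : nat}.
Context (A : 'M[R]_n) (B : 'M[R]_(n, m)) (M W2 : 'M[R]_(n + m)).
Hypotheses (MT : M^T = M) (W2T : W2^T = W2).
Local Notation Mt := (Mtilde M W2).
Local Notation rS := (riccati_S B M W2).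
Local Notation rK := (riccati_K A B M W2).
Local Notation step := (riccati_step A B M W2).

Lemma Mtilde_cont lam : mx_continuous lam Mt.
Proof.
apply: mxc_add => [|i j]; first exact: mxc_cst.
under eq_fun do rewrite mxE.
by apply: contM; [exact: cvg_id|exact: cont_cst].
Qed.

Lemma quad_cont lam p q (C : 'M[R]_(n, p)) (D : 'M[R]_(n, q)) X :
  mx_continuous lam X -> mx_continuous lam (fun l => C^T *m X l *m D).
Proof.
by move=> Xc; apply: mxc_mul; [apply: mxc_mul => //|]; exact: mxc_cst.
Qed.

Lemma riccati_S_cont lam X :
  mx_continuous lam X -> mx_continuous lam (fun l => rS l (X l)).
Proof.
move=> Xc; apply: mxc_add; last exact: quad_cont.
by move=> i j; under eq_fun do rewrite 2!mxE; exact: Mtilde_cont.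
Qed.

Lemma riccati_ux_cont lam X : mx_continuous lam X ->
  mx_continuous lam (fun l => dlsubmx (Mt l) + B^T *m X l *m A).
Proof.
move=> Xc; apply: mxc_add; last exact: quad_cont.
by move=> i j; under eq_fun do rewrite 2!mxE; exact: Mtilde_cont.
Qed.

Lemma riccati_K_cont lam X : mx_continuous lam X ->
  rS lam (X lam) \in unitmx -> mx_continuous lam (fun l => rK l (X l)).
Proof.
move=> Xc uS; apply: mxc_mul; last exact: riccati_ux_cont.
by apply: mxc_invmx => //; exact: riccati_S_cont.
Qed.

Lemma riccati_step_cont lam X : mx_continuous lam X ->
  rS lam (X lam) \in unitmx -> mx_continuous lam (fun l => step l (X l)).
Proof.
move=> Xc uS; apply: mxc_add.
  apply: mxc_add; last exact: quad_cont.
  by move=> i j; under eq_fun do rewrite 2!mxE; exact: Mtilde_cont.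
apply/mxc_opp/mxc_mul; last exact: riccati_K_cont.
by apply: mxc_tr; exact: riccati_ux_cont.
Qed.

Lemma riccati_iter_cont H lam k : Lambda H A B M W2 lam -> (k <= H)%N ->
  mx_continuous lam (fun l => iter k (step l) 0).
Proof.
move=> /LambdaP[_ pS]; elim: k => [_|k IH kH]; first exact: mxc_cst.
by apply: riccati_step_cont (IH (ltnW kH)) _; exact/posdef_unitmx/pS.
Qed.

Lemma K_cont H lam t : Lambda H A B M W2 lam -> (t < H)%N ->
  mx_continuous lam (fun l => K_ H A B M W2 l t).
Proof.
move=> La tH; apply: riccati_K_cont; last exact/posdef_unitmx/La.2.
by apply: riccati_iter_cont La _; exact: leq_subr.
Qed.

Lemma Lambda_open H (lam : R) : 0 < lam -> Lambda H A B M W2 lam ->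
  exists2 l, l < lam & Lambda H A B M W2 l.
Proof.
move=> lam0 La.
have nS (t : 'I_H) : \forall l \near lam, posdef (S_ H A B M W2 l t).
  apply: posdef_near; last exact: La.2.
    by move=> l; apply: riccati_S_sym => //; exact: iter_step_sym.
  by apply: riccati_S_cont; apply: riccati_iter_cont La _; exact: leq_subr.
have {}nS := filter_forall (nbhs_filter lam) nS.
have np : \forall l \near lam, 0 < l by exact: lt_nbhsr.
have /nbhs_ballP[e /= e0 ball_e] : \forall l \near lam,
    0 < l /\ forall t : 'I_H, posdef (S_ H A B M W2 l t).
  exact: (filterI np nS).
exists (lam - e / 2); first by rewrite gtrBl divr_gt0.
have [|l0 pS] := ball_e (lam - e / 2).
  rewrite /ball /= opprB addrC subrK ger0_norm ?divr_ge0 ?ltW //.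
  by rewrite ltr_pdivrMr // ltr_pMr // ltr1n.
by split=> [|t tH]; [exact: ltW|exact: (pS (Ordinal tH))].
Qed.

(** Under linear feedback the second moments follow a recursion driven by the
    gains, so they are as continuous as the gains. *)
Lemma moment_sequence_cont H Sw lam (Z : R -> nat -> 'M[R]_(n + m)) t :
  (forall l, moment_sequence H A B Sw (Z l)) ->
  (forall l t, (t < H)%N -> let G := feedback_mx (K_ H A B M W2 l t) in
     Z l t = G *m ulsubmx (Z l t) *m G^T) ->
  Lambda H A B M W2 lam -> (t < H)%N -> mx_continuous lam (Z ^~ t).
Proof.
move=> mZ ZE La.
have closed s : (s < H)%N -> mx_continuous lam (fun l => ulsubmx (Z l s)) ->
    mx_continuous lam (Z ^~ s).
  move=> sH uc; under eq_fun do rewrite ZE //.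
  have Gc : mx_continuous lam (fun l => feedback_mx (K_ H A B M W2 l s)).
    move=> i j; case: (split_ordP i) => k ->.
      by under eq_fun do rewrite col_mxEu; exact: cont_cst.
    by under eq_fun do rewrite col_mxEd; exact/mxc_opp/K_cont.
  by apply: mxc_mul; [exact: mxc_mul|exact: mxc_tr].
elim: t => [|t IH] tH; apply: closed => //.
  under eq_fun do rewrite (moments_init (mZ _)); exact: mxc_cst.
under eq_fun do rewrite (moments_next (mZ _)) //.
apply: mxc_add; last exact: mxc_cst.
apply: mxc_mul; last exact: mxc_cst.
by apply: mxc_mul; [exact: mxc_cst|exact: IH (ltnW tH)].
Qed.

End riccati_continuity.

(** * Lagrangian duality *)

(** The exchange argument of Lagrangian duality: [b1] and [b2] are the
    constraint values of minimizers for the multipliers [l1] and [l2]. *)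
Lemma budget_exchange (F : realFieldType) (l1 l2 m1 m2 b1 b2 : F) : l1 < l2 ->
  m1 + l1 * b1 <= m2 + l1 * b2 -> m2 + l2 * b2 <= m1 + l2 * b1 -> b2 <= b1.
Proof.
by move=> l12 h1 h2; rewrite -(@ler_pM2l _ (l2 - l1)) ?subr_gt0 //; lra.
Qed.

Lemma qf1_usubmx (F : realType) p q (v : 'cV[F]_(p + q)) :
  qf 1%:M (row_mx 1%:M 0 *m v) <= qf 1%:M v.
Proof.
rewrite -{1}[v]vsubmxK mul_row_col mul1mx mul0mx addr0 !qf1E big_split_ord /=.
rewrite ler_wpDr ?sumr_ge0 // => [i _|]; first exact: sqr_ge0.
by under eq_bigr do rewrite mxE.
Qed.

Section lagrangian.
Context {R : realType} {dT : measure_display} {T : measurableType dT}.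
Context (P : probability T R) (n m H : nat) (A : 'M[R]_n) (B : 'M[R]_(n, m)).
Context (w : nat -> T -> 'cV[R]_n) (Sw : 'M[R]_n) (W2 M : 'M[R]_(n + m)).
Hypotheses (m_gt0 : (0 < m)%N) (H_gt0 : (0 < H)%N).
Hypotheses (w_iid : iid P H w) (w_mean : zero_mean P H w).
Hypotheses (w_cov : has_covariance P H w Sw) (Sw_pos : posdef Sw).
Hypotheses (W2_pos : posdef W2) (M_neg : negdef M).

Local Notation Lam := (Lambda H A B M W2).
Local Notation pi_ := (feedback H A B M W2).
Local Notation Pi := (Pi P H A B w).
Local Notation Sig := (Sigma P H A B w).
Local Notation b := (budget P H A B w M W2).
Local Notation b0 := (min_cost P H A B w W2).
Local Notation Mt := (Mtilde M W2).
Local Notation mu := (lambda_min W2).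
Local Notation r := (spectral_norm M / mu).

Let d_gt0 : (0 < n + m)%N. Proof. by rewrite addn_gt0 m_gt0 orbT. Qed.
Let W2T : W2^T = W2. Proof. exact: W2_pos.1. Qed.
Let MT : M^T = M.
Proof. by have := M_neg.1; rewrite linearN /= => /oppr_inj. Qed.
Let mu_gt0 : 0 < mu. Proof. exact: lambda_min_gt0. Qed.
Let r_gt0 : 0 < r. Proof. by rewrite divr_gt0 // spectral_norm_gt0. Qed.

Lemma Mtilde_lower lam v : 0 <= lam ->
  (lam - r) * mu * qf 1%:M v <= qf (Mt lam) v.
Proof.
move=> lam0; rewrite /Mtilde qfD qfZ.
have := spectral_normP M v; rewrite ler_norml => /andP[leM _].
have := ler_wpM2l lam0 ((lambda_min_spec d_gt0 W2T).1 v).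
rewrite mulrBl divfK ?gt_eqF // mulrBl; lra.
Qed.

Lemma Lambda_large lam : r < lam -> Lam lam.
Proof.
move=> rl; have lam0 : 0 <= lam by apply: ltW; exact: lt_trans rl.
apply: Lambda_posdef => //; split; first exact: Mtilde_sym.
move=> v v0; apply: lt_le_trans (Mtilde_lower v lam0).
by rewrite !mulr_gt0 ?qf1_gt0 // subr_gt0.
Qed.

(** The last matrix [S_(H-1)] is the input block of [M + lam W2], which is
    negative on a fixed nonzero input until [lam] exceeds a positive ratio. *)
Lemma Lambda_lower_bound : exists2 a, 0 < a & forall lam, Lam lam -> a < lam.
Proof.
pose z : 'cV[R]_(n + m) := col_mx 0 (const_mx 1).
have u0 : const_mx 1 != 0 :> 'cV[R]_m.
  apply/eqP => /colP /(_ (Ordinal m_gt0)); rewrite !mxE => /eqP.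
  by rewrite oner_eq0.
have z0 : z != 0.
  by apply: contra u0 => /eqP e; rewrite -(col_mxKd (0 : 'cV_n) (const_mx 1))
    -/z e linear0.
have Wz := W2_pos.2 z z0; have := M_neg.2 z z0.
rewrite -!/(qf _ _) qfN oppr_gt0 in Wz * => Mz.
exists (- qf M z / qf W2 z); first by rewrite divr_gt0 // oppr_gt0.
move=> lam /LambdaP[_ /(_ 0%N H_gt0) [_ /(_ _ u0)]] /=.
rewrite -/(qf _ _) (qf_rS A) // qfD qf_mul /Mtilde qfD qfZ.
rewrite -/z [qf 0 _]/qf mulmx0 mul0mx mxE addr0 ltr_pdivrMr //; lra.
Qed.

(** Upward closed and without least element, [Lambda] is an open ray. *)
Lemma Lambda_ray :
  [/\ Lam = [set lam | inf Lam < lam], 0 < inf Lam & inf Lam <= r].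
Proof.
have [a a0 La] := Lambda_lower_bound.
have lbL : has_lbound Lam by exists a => l /La /ltW.
have Lr l : r < l -> inf Lam <= l by move=> /Lambda_large; exact: inf_lbound.
have neL : Lam !=set0 by exists (r + 1); apply: Lambda_large; rewrite ltrDl.
split.
- apply/seteqP; split=> l /= Ll.
    have [l' l'l Ll'] := Lambda_open MT W2T (lt_trans a0 (La l Ll)) Ll.
    exact: le_lt_trans (inf_lbound lbL Ll') l'l.
  have ll : 0 < l - inf Lam by rewrite subr_gt0.
  have [l' Ll'] := inf_adherent ll (conj neL lbL).
  rewrite addrC subrK => /ltW; apply: Lambda_up => //; exact: posdef_psd.
- by apply: lt_le_trans a0 _; apply: lb_le_inf => // l /La /ltW.
- by apply/ler_addgt0Pr => e e0; apply: Lr; rewrite ltrDl.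
Qed.

Let Pi_pi lam : Pi (pi_ lam).
Proof. exact: (feedback_Pi A B w_iid w_cov M W2 lam). Qed.

Lemma Sigma_moment_sequence pi : Pi pi ->
  exists2 Z, moment_sequence H A B Sw Z &
  Sig pi = \sum_(t < H) Z t.
Proof.
move=> Ppi; exists (second_moment P A B w pi).
  exact (policy_moment_sequence w_iid w_mean w_cov Ppi).
exact (Sigma_policy w_iid Ppi).
Qed.

Lemma Sigma_psd pi W : Pi pi -> psd W -> 0 <= \tr (W *m Sig pi).
Proof.
move=> /Sigma_moment_sequence[Z mZ ->] W0; rewrite mulmx_sumr linear_sum /=.
by apply: sumr_ge0 => t _; exact: (moments_ge0 mZ).
Qed.

(** The decomposed cost has a policy-independent part and a nonnegative part
    that vanishes at the Riccati feedback. *)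
Lemma lagrangian_optimal lam pi : Lam lam -> Pi pi ->
  \tr (M *m Sig (pi_ lam)) + lam * b lam <=
  \tr (M *m Sig pi) + lam * \tr (W2 *m Sig pi).
Proof.
move=> Ll Ppi.
have cost pi' : \tr (M *m Sig pi') + lam * \tr (W2 *m Sig pi') =
    \tr (Mt lam *m Sig pi').
  by rewrite /Mtilde mulmxDl mxtraceD -scalemxAl mxtraceZ.
have [Z mZ ZE] := Sigma_moment_sequence Ppi.
rewrite /budget !cost ZE.
rewrite (Sigma_policy w_iid (Pi_pi lam)).
have mL := policy_moment_sequence w_iid w_mean w_cov (Pi_pi lam).
rewrite (cost_decomposition MT W2T Ll mL) (cost_decomposition MT W2T Ll mZ).
have fb := second_moment_feedback A B w_iid w_cov M W2 lam.
rewrite (residual_cost_feedback fb).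
by rewrite lerD2l (residual_cost_ge0 Ll mZ).
Qed.

Lemma budget_nonincreasing lam1 lam2 :
  Lam lam1 -> Lam lam2 -> lam1 <= lam2 -> b lam2 <= b lam1.
Proof.
move=> L1 L2; rewrite le_eqVlt => /predU1P[->//|lt12].
exact: budget_exchange lt12 (lagrangian_optimal L1 (Pi_pi lam2))
                        (lagrangian_optimal L2 (Pi_pi lam1)).
Qed.

Lemma budget_cont lam : Lam lam -> cont_at lam b.
Proof.
move=> Ll; rewrite /cont_at /budget.
have Zc (t : 'I_H) :
    mx_continuous lam (fun l => second_moment P A B w (pi_ l) t).
  apply: (@moment_sequence_cont _ _ _ A B M W2 H Sw lam
    (fun l => second_moment P A B w (pi_ l))) => //.
    by move=> l; exact (policy_moment_sequence w_iid w_mean w_cov (Pi_pi l)).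
  by move=> l s sH; exact: (second_moment_feedback A B w_iid w_cov).
have Sc : mx_continuous lam (fun l => Sig (pi_ l)).
  under eq_fun => l do rewrite (Sigma_policy w_iid (Pi_pi l)).
  exact: mxc_sum.
by apply: mxc_trace; apply: mxc_mul => //; exact: mxc_cst.
Qed.

Lemma min_cost_ge c : (forall pi, Pi pi -> c <= \tr (W2 *m Sig pi)) -> c <= b0.
Proof.
move=> cP; apply: lb_le_inf; last by move=> _ [pi Ppi ->]; exact: cP.
by exists (\tr (W2 *m Sig (pi_ 0))), (pi_ 0) => //; exact: Pi_pi.
Qed.

Lemma psd_trace_gt0 p (S : 'M[R]_p) : (0 < p)%N -> posdef S -> 0 < \tr S.
Proof.
move=> p0 pS.
have S0 i : 0 < S i i.
  have d0 : delta_mx i 0 != 0 :> 'cV[R]_p.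
    apply/eqP => /colP /(_ i); rewrite !mxE !eqxx => /eqP.
    by rewrite oner_eq0.
  have := pS.2 _ d0; rewrite trmx_delta -rowE -colE !mxE; exact.
rewrite /mxtrace (bigD1 (Ordinal p0)) //=.
by rewrite ltr_wpDr // sumr_ge0 // => i _; exact: ltW.
Qed.

(** With a nontrivial state and at least two stages, the first disturbance
    enters the cost whatever the policy does. *)
Lemma min_cost_gt0 : (0 < n)%N -> (1 < H)%N -> 0 < b0.
Proof.
move=> n0 H1; have t0 := psd_trace_gt0 n0 Sw_pos.
apply: (@lt_le_trans _ _ (mu * \tr Sw)); first exact: mulr_gt0.
apply: min_cost_ge => pi /Sigma_moment_sequence[Z mZ ->].
rewrite mulmx_sumr linear_sum /= (bigD1 (Ordinal H1)) //=.
apply: ler_wpDr.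
  apply: sumr_ge0 => t _; apply: (moments_ge0 mZ) => //; exact: posdef_psd.
pose E : 'M[R]_(n, n + m) := row_mx 1%:M 0.
have EZ : \tr (E^T *m 1%:M *m E *m Z 1%N) = \tr (ulsubmx (Z 1%N)).
  by rewrite tr_ul mul1mx.
have WE : psd (W2 - mu *: (E^T *m 1%:M *m E)).
  move=> v; rewrite qfD qfN qfZ qf_mul subr_ge0.
  apply: le_trans ((lambda_min_spec d_gt0 W2T).1 v).
  by rewrite ler_pM2l // qf1_usubmx.
have := moments_ge0 mZ H1 WE.
rewrite mulmxBl raddfB /= -scalemxAl mxtraceZ EZ subr_ge0; apply: le_trans.
rewrite ler_pM2l // (moments_next mZ H1) mxtraceD lerDr.
have := moments_ge0 mZ H_gt0 (psd_conj (row_mx A B) psd1).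
by rewrite mulmx1 -mulmxA mxtrace_mulC.
Qed.

(** Here the state is identically zero, so the feedback input vanishes, whether
    or not the multiplier is admissible. *)
Lemma budget_degenerate lam : n = 0%N \/ (H <= 1)%N -> b lam = 0.
Proof.
move=> deg; rewrite /budget (Sigma_policy w_iid (Pi_pi lam)).
rewrite big1 ?mulmx0 ?mxtrace0 // => t _.
rewrite (second_moment_feedback A B w_iid w_cov) //.
have -> : ulsubmx (second_moment P A B w (pi_ lam) t) = 0; last first.
  by rewrite mulmx0 mul0mx.
have mZ := policy_moment_sequence w_iid w_mean w_cov (Pi_pi lam).
case: deg => [n0|H1].
  by apply/matrixP => -[i iP]; exfalso; move: iP; rewrite n0.
rewrite (_ : t = 0%N :> nat) ?(moments_init mZ) //.
by have := ltn_ord t; lia.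
Qed.

(** Compare [pi_lam] with any policy in the Lagrangian: the competitor has
    nonpositive [M]-cost, and the [M]-cost of [pi_lam] is at least [- r (b lam)]
    because [M + r W2] is positive semidefinite. *)
Lemma budget_bound lam : r < lam -> (lam - r) * b lam <= lam * b0.
Proof.
move=> rl; have lam0 : 0 < lam by exact: lt_trans rl.
have Ll := Lambda_large rl.
rewrite -ler_pdivrMl //; apply: min_cost_ge => pi Ppi.
rewrite ler_pdivrMl //.
have opt := lagrangian_optimal Ll Ppi.
have M0 : 0 <= \tr (- M *m Sig pi).
  by apply: Sigma_psd => //; exact: posdef_psd.
have Mr : 0 <= \tr (Mt r *m Sig (pi_ lam)).
  apply: Sigma_psd => // v.
  by apply: le_trans (Mtilde_lower v (ltW r_gt0)); rewrite subrr !mul0r.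
move: M0 Mr; rewrite mulNmx raddfN /= /Mtilde mulmxDl mxtraceD -scalemxAl.
rewrite mxtraceZ -/(b lam); lra.
Qed.

(** If [b0 > 0] the threshold exceeds [r] and the bound above applies. Otherwise
    the threshold may equal [r], which need not be admissible, but then the
    state is identically zero. *)
Lemma budget_le beta lam : b0 < beta -> beta / (beta - b0) * r <= lam ->
  b lam <= beta.
Proof.
move=> bb lb.
have b00 : 0 <= b0.
  apply: min_cost_ge => pi Ppi; apply: Sigma_psd => //; exact: posdef_psd.
have beta0 : 0 < beta by exact: le_lt_trans bb.
have [nd|] := boolP ((0 < n)%N && (1 < H)%N); last first.
  rewrite negb_and -!leqNgt leqn0 => deg.
  rewrite budget_degenerate ?ltW //.
  by case/orP: deg => [/eqP|]; [left|right].
have b0p : 0 < b0 by case/andP: nd; exact: min_cost_gt0.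
move: lb; rewrite mulrAC ler_pdivrMr ?subr_gt0 // => lb.
have rl : r < lam.
  rewrite ltNge; apply/negP => lr; have := r_gt0; nra.
have := budget_bound rl => bnd.
rewrite -(@ler_pM2l _ (lam - r)) ?subr_gt0 //; apply: le_trans bnd _; lra.
Qed.

Lemma lagrangian_suboptimality beta lam pi : Lam lam ->
  feasible P H A B w W2 beta pi ->
  \tr (M *m Sig (pi_ lam)) <= \tr (M *m Sig pi) + lam * (beta - b lam).
Proof.
move=> Ll [Ppi le_beta]; have := lagrangian_optimal Ll Ppi.
have := ler_wpM2l Ll.1 le_beta; rewrite -/(b lam); lra.
Qed.

End lagrangian.

Theorem lemma3 (R : realType) (dT : measure_display) (T : measurableType dT)
    (P : probability T R) (n m H : nat) (m_gt0 : (0 < m)%N) (H_gt0 : (0 < H)%N)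
    (A : 'M[R]_n) (B : 'M[R]_(n, m)) (w : nat -> T -> 'cV[R]_n)
    (Sigma_w : 'M[R]_n) (W1 W2 Sigma0 M : 'M[R]_(n + m)) (beta : R)
    (w_iid : iid P H w) (w_mean : zero_mean P H w)
    (w_cov : has_covariance P H w Sigma_w)
    (Sigma_w_pos : posdef Sigma_w) (W1_pos : posdef W1) (W2_pos : posdef W2)
    (Sigma0_pos : posdef Sigma0) (beta_gt0 : 0 < beta)
    (beta_gt_b0 : min_cost P H A B w W2 < beta) (M_neg : negdef M) :
  let mu := lambda_min W2 in
  let b0 := min_cost P H A B w W2 in
  let Lam := Lambda H A B M W2 in
  let lam_crit := inf Lam in
  let pi_ := feedback H A B M W2 in
  let b := budget P H A B w M W2 in
  let lam_bar := beta / (beta - b0) * (spectral_norm M / mu) in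
  (* (i) *)
  [/\ [/\ Lam = [set lam | lam_crit < lam],
          0 < lam_crit, lam_crit <= spectral_norm M / mu
        & forall lam, spectral_norm M / mu < lam -> Lam lam],
  (* (ii) *)
      {within Lam, continuous b} /\
      (forall lam1 lam2, Lam lam1 -> Lam lam2 -> lam1 <= lam2 ->
         b lam2 <= b lam1),
  (* (iii) *)
      (forall lam, Lam lam -> b lam <= beta ->
         [/\ feasible P H A B w W2 beta (pi_ lam),
             \tr (M *m Sigma P H A B w (pi_ lam)) <=
               pstar P H A B w M W2 beta + lam * (beta - b lam)
           & b lam = beta -> optimal P H A B w M W2 beta (pi_ lam)])
  (* (iv) *)
    & forall lam, lam_bar <= lam -> b lam <= beta].
Proof.
move=> mu b0 Lam lam_crit pi_ b lam_bar.
have [LamE crit0 crit_le] := Lambda_ray A B m_gt0 H_gt0 W2_pos M_neg.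
split.
- split=> // lam; exact: Lambda_large.
- split.
    apply: continuous_in_subspaceT => lam; rewrite inE => Ll.
    exact (budget_cont w_iid w_mean w_cov Ll).
  exact (budget_nonincreasing w_iid w_mean w_cov W2_pos M_neg).
- move=> lam Ll bl.
  have feas : feasible P H A B w W2 beta (pi_ lam).
    by split=> //; exact: (feedback_Pi A B w_iid w_cov M W2 lam).
  have sub pi := lagrangian_suboptimality w_iid w_mean w_cov W2_pos M_neg
    (beta := beta) (pi := pi) Ll.
  split=> //.
    rewrite -lerBlDr; apply: lb_le_inf.
      by exists (\tr (M *m Sigma P H A B w (pi_ lam))), (pi_ lam).
    by move=> _ [pi /sub le_pi ->]; rewrite lerBlDr.
  move=> bE; split=> // pi /sub; by rewrite -/b bE subrr mulr0 addr0.
- move=> lam.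
  exact (budget_le m_gt0 H_gt0 w_iid w_mean w_cov Sigma_w_pos W2_pos M_neg
    beta_gt_b0).
Qed.
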